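(* Let $\mathcal V$ be a Borel class of oligomorphic closed subgroups of $\mathrm{Sym}(\omega)$, and let $P$ be an invariant Borel relation, picking open subgroups from groups in $\mathcal V$, that is sub-basic for $\mathcal V$. Suppose that for each $G\in\mathcal V$ there are only finitely many conjugacy classes of $P$-subgroups of $G$. Then: (1) Topological isomorphism on $\mathcal V$ is smooth. (2) $\mathrm{Aut}(G)$ is quasi-oligomorphic for each $G\in\mathcal V$. (3) $\mathrm{Out}(G)$ is profinite for each $G\in\mathcal V$.
   Context: $\mathrm{Sym}(\omega)$ is the Polish group of permutations of $\omega$ (neighbourhood basis of $1$: pointwise stabilisers of finite sets). A subgroup $G\leq\mathrm{Sym}(\omega)$ is oligomorphic if for each $n$ the canonical action of $G$ on $\omega^n$ has only finitely many orbits. The closed subgroups of $\mathrm{Sym}(\omega)$ form a standard Borel space $\mathcal U(S_\infty)$, a Borel subspace of the Effros space of closed subsets of $\mathrm{Sym}(\omega)$ (whose $\sigma$-algebra is generated by the sets $\{F: F\cap W\neq\emptyset\}$, $W$ open); the oligomorphic ones form a Borel subset. A Borel relation picking open subgroups from groups in $\mathcal V$ is a Borel binary relation $P(U,G)$ on $\mathcal U(S_\infty)$ such that $P(U,G)$ implies that $G\in\mathcal V$ and $U$ is an open subgroup of $G$; if $P(U,G)$ holds, $U$ is called a $P$-subgroup of $G$. $P$ is invariant if each topological isomorphism $\Phi\colon G\to H$ between groups $G,H\in\mathcal V$ preserves $P$ (i.e. $P(U,G)\Leftrightarrow P(\Phi(U),H)$). An invariant Borel relation $P$ is sub-basic for $\mathcal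 V$ if each open subgroup of any $G\in\mathcal V$ contains a finite intersection of $P$-subgroups of $G$. An equivalence relation on a Borel class is smooth if there is a Borel map $f$ from the class to $\mathbb R$ (equivalently, to some standard Borel space) such that two elements are equivalent iff they have the same image under $f$. $\mathrm{Aut}(G)$ denotes the group of continuous automorphisms of $G$, with the (Polish) group topology for which a neighbourhood basis of the identity consists of the subgroups $\{\Phi: \Phi(A_i)=A_i \text{ for } i=1,\dots,n\}$, where $A_1,\dots,A_n$ are cosets of open subgroups of $G$. $\mathrm{Out}(G)=\mathrm{Aut}(G)/\mathrm{Inn}(G)$ carries the quotient topology ($\mathrm{Inn}(G)$ is closed). A topological group is quasi-oligomorphic if it is topologically isomorphic to an oligomorphic closed subgroup of $\mathrm{Sym}(\omega)$. *)

(* Defs.v *)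
From HB Require Import structures.
From mathcomp Require Import all_boot all_order all_algebra.
From mathcomp Require Import all_classical all_reals all_analysis.
From mathcomp Require Import generic_quotient.

Set Implicit Arguments.
Unset Strict Implicit.
Unset Printing Implicit Defensive.

Local Open Scope classical_set_scope.
Local Open Scope group_scope.

HB.structure Definition PreTopologicalGroup := {G of Group G & Topological G}.

HB.mixin Record isTopologicalGroup G of Group G & Topological G := {
  mulg_continuous : continuous (fun x : G * G => x.1 * x.2);
  invg_continuous : continuous (fun x : G => x^-1)
}.

#[short(type="topologicalGroupType")]
HB.structure Definition TopologicalGroup :=
  {G of Group G & Topological G & isTopologicalGroup G}.

Definition is_subgroup (G : groupType) (U : set G) : Prop :=
  [/\ U 1, forall x y, U x -> U y -> U (x * y) & forall x, U x -> U x^-1].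

(* The group topology that has a given family of subgroups as a neighbourhood
   basis of the identity. *)
HB.factory Record hasSubgroupBasis G of Group G := {
  sbasis : set (set G);
  sbasis_nonempty : sbasis !=set0;
  sbasis_subgroup : forall V, sbasis V -> is_subgroup V;
  sbasisI : forall V W, sbasis V -> sbasis W ->
    exists2 U, sbasis U & U `<=` V `&` W;
  sbasisJ : forall V (g : G), sbasis V ->
    exists2 U, sbasis U & forall x, U x -> V (x ^ g)
}.

HB.builders Context G of hasSubgroupBasis G.

Let nb (x : G) : set (set G) :=
  [set A | exists2 V, sbasis V & forall v, V v -> A (x * v)].

HB.instance Definition _ := hasNbhs.Build G nb.

Lemma nb_filter (p : G) : ProperFilter (nb p).
Proof.
split.
  by case=> V /sbasis_subgroup[V1 _ _] /(_ _ V1).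
split.
- by have [V bV] := sbasis_nonempty; exists V.
- move=> A B [V bV VA] [W bW WB]; have [U bU UVW] := sbasisI bV bW.
  by exists U => // u /UVW[Vu Wu]; split; [exact: VA|exact: WB].
- by move=> A B AB [V bV VA]; exists V => // v /VA; exact: AB.
Qed.

Lemma nb_singleton (p : G) (A : set G) : nb p A -> A p.
Proof. by case=> V /sbasis_subgroup[V1 _ _] /(_ _ V1); rewrite mulg1. Qed.

Lemma nb_nb (p : G) (A : set G) : nb p A -> nb p (nb^~ A).
Proof.
case=> V bV VA; have [_ VM _] := sbasis_subgroup bV.
by exists V => // v Vv; exists V => // w Vw; rewrite -mulgA; apply: VA; apply: VM.
Qed.

HB.instance Definition _ :=
  Nbhs_isNbhsTopological.Build G nb_filter nb_singleton nb_nb.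

Lemma mul_cont : continuous (fun x : G * G => x.1 * x.2).
Proof.
move=> [x y] A [V bV VA].
have [_ VM _] := sbasis_subgroup bV.
have [U bU UV] := sbasisJ y bV.
exists ([set x * u | u in U], [set y * v | v in V]) => /=.
  split; [exists U|exists V] => // z ?; exists z => //.
move=> [_ _] [/= [u Uu <-] [v Vv <-]].
have -> : x * u * (y * v) = x * y * (u ^ y * v).
  by rewrite /conjg !mulgA mulgK.
by apply: VA; apply: VM => //; apply: UV.
Qed.

Lemma inv_cont : continuous (fun x : G => x^-1).
Proof.
move=> x A [V bV VA].
have [_ _ VV] := sbasis_subgroup bV.
have [U bU UV] := sbasisJ x^-1 bV.
exists U => // u Uu /=.
have -> : (x * u)^-1 = x^-1 * (u ^ x^-1)^-1.
  by rewrite /conjg !invgM !invgK !mulgA mulVg mul1g.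
by apply: VA; apply: VV; apply: UV.
Qed.

HB.instance Definition _ := isTopologicalGroup.Build G mul_cont inv_cont.

HB.end.

Definition open_subgroup (G : topologicalGroupType) (U : set G) : Prop :=
  is_subgroup U /\ open U.

(* Left cosets only: a right coset of U is a left coset of a conjugate of U. *)
Definition open_subgroup_coset (G : topologicalGroupType) (A : set G) : Prop :=
  exists2 U : set G, open_subgroup U & exists x, A = [set x * u | u in U].

Definition topological_isomorphism (G H : topologicalGroupType) (phi : G -> H)
    : Prop :=
  [/\ {morph phi : x y / x * y}, continuous phi &
      exists2 psi : H -> G, continuous psi & cancel phi psi /\ cancel psi phi].

Definition topologically_isomorphic (G H : topologicalGroupType) : Prop :=
  exists phi : G -> H, topological_isomorphism phi.

Definition profinite (G : topologicalGroupType) : Prop :=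
  [/\ compact [set: G], hausdorff_space G & totally_disconnected [set: G]].

Section QuotientGroup.
Local Open Scope quotient_scope.
Context (G : topologicalGroupType).

Record normal_subgroup := NormalSubgroup {
  nsub_set :> set G;
  nsub_subgroup : is_subgroup nsub_set;
  nsub_normal : forall x g, nsub_set x -> nsub_set (x ^ g)
}.

Variable N : normal_subgroup.

Definition coset_rel (x y : G) : bool := `[< nsub_set N (x^-1 * y) >].

Lemma coset_rel_equiv : equiv_class_of coset_rel.
Proof.
have [N1 NM NV] := nsub_subgroup N.
split.
- by move=> x; apply/asboolP; rewrite mulVg.
- move=> x y; apply/asbool_equiv_eq; split=> /NV.
    by rewrite invgM invgK.
  by rewrite invgM invgK.
- move=> y x z /asboolP xy /asboolP yz; apply/asboolP.
  by have := NM _ _ xy yz; rewrite mulgA mulgK.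
Qed.

Canonical coset_equiv := EquivRelPack coset_rel_equiv.

Definition quotient_group : Type := quotient_topology {eq_quot coset_equiv}.

HB.instance Definition _ := Quotient.on quotient_group.
HB.instance Definition _ := Topological.on quotient_group.

Local Notation pi := (\pi_quotient_group : G -> quotient_group).

Lemma piP (x y : G) : pi x = pi y <-> nsub_set N (x^-1 * y).
Proof.
split.
  by move=> /(@eqmodP _ coset_equiv x y) /asboolP.
by move=> Nxy; apply/(@eqmodP _ coset_equiv x y)/asboolP.
Qed.

Lemma pi_repr (q : quotient_group) : pi (repr q) = q.
Proof. exact: reprK. Qed.

Definition quot_mul (p q : quotient_group) : quotient_group :=
  pi (repr p * repr q).
Definition quot_inv (p : quotient_group) : quotient_group := pi (repr p)^-1.

Lemma pi_mul x y : quot_mul (pi x) (pi y) = pi (x * y).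
Proof.
have [_ NM NV] := nsub_subgroup N.
have /piP := pi_repr (pi x); set x' := repr _ => Nx.
have /piP := pi_repr (pi y); set y' := repr _ => Ny.
apply/piP; rewrite -/x' -/y'.
have -> : (x' * y')^-1 * (x * y) = (x'^-1 * x) ^ y' * (y'^-1 * y).
  by rewrite /conjg invgM !mulgA mulgK.
by apply: NM => //; exact: nsub_normal.
Qed.

Lemma pi_inv x : quot_inv (pi x) = pi x^-1.
Proof.
have [_ NM NV] := nsub_subgroup N.
have /piP := pi_repr (pi x); set x' := repr _ => Nx.
apply/piP; rewrite -/x'.
have -> : x'^-1^-1 * x^-1 = ((x'^-1 * x) ^ x'^-1)^-1.
  by rewrite /conjg !invgM !invgK !mulgA mulgK.
by apply: NV; exact: nsub_normal.
Qed.

Lemma quot_mulA : associative quot_mul.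
Proof.
move=> p q r; rewrite -(pi_repr p) -(pi_repr q) -(pi_repr r).
by rewrite !pi_mul mulgA.
Qed.
Lemma quot_mul1g : left_id (pi 1) quot_mul.
Proof. by move=> p; rewrite -(pi_repr p) pi_mul mul1g. Qed.
Lemma quot_mulg1 : right_id (pi 1) quot_mul.
Proof. by move=> p; rewrite -(pi_repr p) pi_mul mulg1. Qed.
Lemma quot_mulVg : left_inverse (pi 1) quot_inv quot_mul.
Proof. by move=> p; rewrite -(pi_repr p) pi_inv pi_mul mulVg. Qed.
Lemma quot_mulgV : right_inverse (pi 1) quot_inv quot_mul.
Proof. by move=> p; rewrite -(pi_repr p) pi_inv pi_mul mulgV. Qed.

HB.instance Definition _ := isGroup.Build quotient_group
  quot_mulA quot_mul1g quot_mulg1 quot_mulVg quot_mulgV.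

Lemma pi_cont : continuous pi.
Proof. exact: pi_continuous. Qed.

Lemma mulgl_open (U : set G) g : open U -> open [set u * g | u in U].
Proof.
move=> oU.
have -> : [set u * g | u in U] = (fun x => x * g^-1) @^-1` U.
  apply/seteqP; split=> x /=; first by case=> u Uu <-; rewrite mulgK.
  by move=> Ux; exists (x * g^-1) => //; rewrite mulgVK.
apply: open_comp => // x _.
apply: (@continuous_comp _ _ _ (fun x => (x, g^-1)) (fun x : G * G => x.1 * x.2)).
  by apply: cvg_pair => /=; [exact: cvg_id|exact: cvg_cst].
exact: mulg_continuous.
Qed.

Lemma pi_open (U : set G) : open U -> open (pi @` U).
Proof.
move=> oU; have [_ _ NV] := nsub_subgroup N.
rewrite /open/= /quotient_open.
have -> : \pi_quotient_group @^-1` (pi @` U) =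
    \bigcup_(n in nsub_set N) [set u * n | u in U].
  apply/seteqP; split=> x /=.
    by case=> u Uu /piP Nux; exists (u^-1 * x) => //; exists u => //; rewrite mulgA mulgV mul1g.
  case=> n Nn [u Uu <-]; exists u => //; apply/piP.
  by rewrite mulgA mulVg mul1g.
by apply: bigcup_open => n _; exact: mulgl_open.
Qed.

Lemma pi_nbhs (x : G) (A : set G) : nbhs x A -> nbhs (pi x) (pi @` A).
Proof.
rewrite nbhsE => -[U [oU Ux] UA].
rewrite nbhsE; exists (pi @` U); last exact: image_subset.
by split; [exact: pi_open|exists x].
Qed.

Lemma quot_mul_cont :
  continuous (fun x : quotient_group * quotient_group => x.1 * x.2).
Proof.
move=> [p q] A; rewrite -(pi_repr p) -(pi_repr q).
set x := repr p; set y := repr q => /=.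
have -> : (pi x * pi y) = pi (x * y) by exact: pi_mul.
move=> /pi_cont; rewrite /nbhs/= => nA.
have [[U W] [/= nU nW] UW] := @mulg_continuous G (x, y) _ nA.
exists (pi @` U, pi @` W) => /=; first by split; exact: pi_nbhs.
move=> [_ _] [/= [u Uu <-] [w Ww <-]].
have -> : (pi u * pi w) = pi (u * w) by exact: pi_mul.
exact: (UW (u, w)).
Qed.

Lemma quot_inv_cont : continuous (fun x : quotient_group => x^-1).
Proof.
move=> p A; rewrite -(pi_repr p); set x := repr p.
have -> : (pi x)^-1 = pi x^-1 by exact: pi_inv.
move=> /pi_cont nA.
have /pi_nbhs := @invg_continuous G x _ nA.
apply: filterS => _ [u /= Au <-].
by have -> : (pi u)^-1 = pi u^-1 by exact: pi_inv.
Qed.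

HB.instance Definition _ :=
  isTopologicalGroup.Build quotient_group quot_mul_cont quot_inv_cont.

End QuotientGroup.

Section AutomorphismGroup.
Context (G : topologicalGroupType).

(* Automorphisms with continuous inverse; for Polish G the inverse of a
   continuous automorphism is automatically continuous. *)
Record Aut := MkAut {
  aut_fun :> G -> G;
  aut_iso : topological_isomorphism aut_fun
}.

HB.instance Definition _ := gen_eqMixin Aut.
HB.instance Definition _ := gen_choiceMixin Aut.

Lemma Aut_ext (f g : Aut) : f =1 g -> f = g.
Proof.
case: f g => [f fP] [g gP] /= /funext fg; subst g.
by rewrite (Prop_irrelevance fP gP).
Qed.

Lemma aut_id_iso : topological_isomorphism (@id G).
Proof.
have idc : continuous (@id G) by move=> x; exact: cvg_id.
by split=> //; exists id.
Qed.

Lemma aut_comp_iso (f g : Aut) : topological_isomorphism (f \o g).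
Proof.
case: f g => [f [fM fc [f' f'c [ff' f'f]]]] [g [gM gc [g' g'c [gg' g'g]]]] /=.
split.
- by move=> x y /=; rewrite gM fM.
- by move=> x; apply: continuous_comp; [exact: gc|exact: fc].
- exists (g' \o f').
    by move=> x; apply: continuous_comp; [exact: f'c|exact: g'c].
  by split=> x /=; rewrite ?ff' ?gg' ?g'g ?f'f.
Qed.

Lemma aut_inv_ex (f : Aut) :
  exists g : G -> G, [/\ topological_isomorphism g, cancel f g & cancel g f].
Proof.
case: f => f [fM fc [g gc [fg gf]]] /=; exists g; split=> //; split=> //.
  by move=> x y; rewrite -{1}(gf x) -{1}(gf y) -fM fg.
by exists f.
Qed.

Definition aut_one : Aut := MkAut aut_id_iso.
Definition aut_mul (f g : Aut) : Aut := MkAut (aut_comp_iso f g).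
Definition aut_inv (f : Aut) : Aut :=
  let: exist _ gP := cid (aut_inv_ex f) in
  let: And3 g_iso _ _ := gP in MkAut g_iso.

Lemma aut_invK (f : Aut) : cancel f (aut_inv f).
Proof. by rewrite /aut_inv; case: cid => g []. Qed.
Lemma aut_invVK (f : Aut) : cancel (aut_inv f) f.
Proof. by rewrite /aut_inv; case: cid => g []. Qed.

Lemma aut_mulA : associative aut_mul.
Proof. by move=> f g h; exact: Aut_ext. Qed.
Lemma aut_mul1g : left_id aut_one aut_mul.
Proof. by move=> f; exact: Aut_ext. Qed.
Lemma aut_mulg1 : right_id aut_one aut_mul.
Proof. by move=> f; exact: Aut_ext. Qed.
Lemma aut_mulVg : left_inverse aut_one aut_inv aut_mul.
Proof. by move=> f; apply: Aut_ext; exact: aut_invK. Qed.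
Lemma aut_mulgV : right_inverse aut_one aut_inv aut_mul.
Proof. by move=> f; apply: Aut_ext; exact: aut_invVK. Qed.

HB.instance Definition _ := isGroup.Build Aut
  aut_mulA aut_mul1g aut_mulg1 aut_mulVg aut_mulgV.

Definition setwise_stabilizer (F : set (set G)) : set Aut :=
  [set phi : Aut | forall A, F A -> phi @` A = A].

Definition aut_basis : set (set Aut) :=
  [set V | exists F : set (set G), [/\ finite_set F,
     (forall A, F A -> open_subgroup_coset A) & V = setwise_stabilizer F]].

Lemma aut_basis_nonempty : aut_basis !=set0.
Proof. by exists (setwise_stabilizer set0), set0; split. Qed.

Lemma aut_basis_subgroup V : aut_basis V -> is_subgroup V.
Proof.
case=> F [_ _ ->]; split.
- by move=> A _; rewrite image_id.
- move=> f g Hf Hg A FA.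
  by rewrite -[LHS]/((f \o g) @` A) -image_comp Hg// Hf.
- move=> f Hf A FA; rewrite -[in LHS](Hf A FA) image_comp.
  by rewrite [X in X @` _](_ : _ = id) ?image_id//; apply/funext => x /=; exact: aut_invK.
Qed.

Lemma aut_basisI V W : aut_basis V -> aut_basis W ->
  exists2 U, aut_basis U & U `<=` V `&` W.
Proof.
move=> [E [fE cE ->]] [F [fF cF ->]]; exists (setwise_stabilizer (E `|` F)).
  exists (E `|` F); split => //; first by rewrite finite_setU.
  by move=> A [/cE|/cF].
by move=> phi H; split=> A ?; apply: H; [left|right].
Qed.

Lemma open_subgroup_coset_image (f : Aut) (A : set G) :
  open_subgroup_coset A -> open_subgroup_coset (f @` A).
Proof.
case=> U [[U1 UM UV] oU] [x ->].
have [fM fc [g gc [fg gf]]] := aut_iso f.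
have gM y z : g (y * z) = g y * g z.
  by rewrite -{1}(gf y) -{1}(gf z) -fM fg.
have g1 : g 1 = 1 by apply: (@mulgI _ (g 1)); rewrite -gM !mulg1.
have gV y : g y^-1 = (g y)^-1.
  by apply: (@mulgI _ (g y)); rewrite -gM !mulgV.
have -> : f @` [set x * u | u in U] = [set f x * u | u in g @^-1` U].
  apply/seteqP; split=> y /=.
    by case=> _ [u Uu <-] <-; exists (f u); rewrite ?fg ?fM.
  case=> u Uu <-; exists (x * g u); last by rewrite fM gf.
  by exists (g u).
exists (g @^-1` U); last by exists (f x).
split; last by apply: open_comp => // z _; exact: gc.
split=> /=; first by rewrite g1.
- by move=> y z /=; rewrite gM; exact: UM.
- by move=> y /=; rewrite gV; exact: UV.
Qed.

Lemma aut_basisJ V (f : Aut) : aut_basis V ->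
  exists2 U, aut_basis U & forall x, U x -> V (x ^ f).
Proof.
case=> F [fF cF ->].
exists (setwise_stabilizer [set f @` A | A in F]).
  exists [set f @` A | A in F]; split => //; first exact: finite_image.
  by move=> _ [A /cF cA <-]; exact: open_subgroup_coset_image.
move=> x Hx A FA.
have -> : aut_fun (x ^ f) = aut_inv f \o (x \o f) by [].
rewrite -image_comp -image_comp Hx; last by exists A.
rewrite image_comp.
by rewrite [X in X @` _](_ : _ = id) ?image_id//; apply/funext => z /=; exact: aut_invK.
Qed.

HB.instance Definition _ := hasSubgroupBasis.Build Aut
  aut_basis_nonempty aut_basis_subgroup aut_basisI aut_basisJ.

Definition Inn_set : set Aut :=
  [set phi : Aut | exists g : G, forall x, phi x = g * x * g^-1].

Lemma Inn_subgroup : is_subgroup Inn_set.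
Proof.
split.
- by exists 1 => x; rewrite mul1g invg1 mulg1.
- move=> f g [a fE] [b gE]; exists (a * b) => x.
  by rewrite -[LHS]/(f (g x)) fE gE invgM !mulgA.
- move=> f [a fE]; exists a^-1 => x.
  rewrite -[X in _ * X * _](aut_invVK f) fE invgK.
  by rewrite !mulgA mulVg mul1g mulgVK.
Qed.

Lemma Inn_normal (f g : Aut) : Inn_set f -> Inn_set (f ^ g).
Proof.
case=> a fE; exists (g^-1 a) => x.
rewrite -[LHS]/(g^-1 (f (g x))) fE.
have [VM _ _] := aut_iso g^-1.
have V1 : g^-1 1 = 1 by apply: (@mulgI _ (g^-1 1)); rewrite -VM !mulg1.
have VV y : g^-1 y^-1 = (g^-1 y)^-1.
  by apply: (@mulgI _ (g^-1 y)); rewrite -VM !mulgV.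
by rewrite !VM VV [X in _ * X * _]aut_invK.
Qed.

Definition Inn : normal_subgroup Aut := NormalSubgroup Inn_subgroup Inn_normal.

Definition Out : topologicalGroupType := quotient_group Inn.

End AutomorphismGroup.

Section SymmetricGroup.

Record Sym := MkSym {
  sym_fun :> nat -> nat;
  sym_bij : bijective sym_fun
}.

HB.instance Definition _ := gen_eqMixin Sym.
HB.instance Definition _ := gen_choiceMixin Sym.

Lemma Sym_ext (f g : Sym) : f =1 g -> f = g.
Proof.
case: f g => [f fP] [g gP] /= /funext fg; subst g.
by rewrite (Prop_irrelevance fP gP).
Qed.

Lemma sym_inv_ex (f : Sym) : exists g : nat -> nat, cancel f g /\ cancel g f.
Proof. by case: f => f [g fg gf]; exists g. Qed.

Lemma sym_id_bij : bijective (@id nat).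
Proof. by exists id. Qed.

Definition sym_one : Sym := MkSym sym_id_bij.
(* Functional composition: (f * g) n = f (g n). *)
Definition sym_mul (f g : Sym) : Sym := MkSym (bij_comp (sym_bij f) (sym_bij g)).
Definition sym_inv (f : Sym) : Sym :=
  let: exist g gP := cid (sym_inv_ex f) in
  MkSym (Bijective gP.2 gP.1).

Lemma sym_invK (f : Sym) : cancel f (sym_inv f).
Proof. by rewrite /sym_inv; case: cid => g []. Qed.
Lemma sym_invVK (f : Sym) : cancel (sym_inv f) f.
Proof. by rewrite /sym_inv; case: cid => g []. Qed.

Lemma sym_mulA : associative sym_mul.
Proof. by move=> f g h; exact: Sym_ext. Qed.
Lemma sym_mul1g : left_id sym_one sym_mul.
Proof. by move=> f; exact: Sym_ext. Qed.
Lemma sym_mulg1 : right_id sym_one sym_mul.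
Proof. by move=> f; exact: Sym_ext. Qed.
Lemma sym_mulVg : left_inverse sym_one sym_inv sym_mul.
Proof. by move=> f; apply: Sym_ext; exact: sym_invK. Qed.
Lemma sym_mulgV : right_inverse sym_one sym_inv sym_mul.
Proof. by move=> f; apply: Sym_ext; exact: sym_invVK. Qed.

HB.instance Definition _ := isGroup.Build Sym
  sym_mulA sym_mul1g sym_mulg1 sym_mulVg sym_mulgV.

Definition pointwise_stabilizer (A : set nat) : set Sym :=
  [set g : Sym | forall i, A i -> g i = i].

Definition sym_basis : set (set Sym) :=
  [set V | exists2 A : set nat, finite_set A & V = pointwise_stabilizer A].

Lemma sym_basis_nonempty : sym_basis !=set0.
Proof. by exists (pointwise_stabilizer set0), set0. Qed.

Lemma sym_basis_subgroup V : sym_basis V -> is_subgroup V.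
Proof.
case=> A _ ->; split=> //.
- by move=> f g Hf Hg i Ai; rewrite -[LHS]/(f (g i)) Hg// Hf.
- by move=> f Hf i Ai; rewrite -{1}(Hf i Ai); exact: sym_invK.
Qed.

Lemma sym_basisI V W : sym_basis V -> sym_basis W ->
  exists2 U, sym_basis U & U `<=` V `&` W.
Proof.
move=> [A fA ->] [B fB ->]; exists (pointwise_stabilizer (A `|` B)).
  by exists (A `|` B) => //; rewrite finite_setU.
by move=> f H; split=> i ?; apply: H; [left|right].
Qed.

Lemma sym_basisJ V (f : Sym) : sym_basis V ->
  exists2 U, sym_basis U & forall x, U x -> V (x ^ f).
Proof.
case=> A fA ->; exists (pointwise_stabilizer (f @` A)).
  by exists (f @` A) => //; exact: finite_image.
move=> x Hx i Ai; rewrite -[LHS]/(sym_inv f (x (f i))) Hx; last by exists i.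
exact: sym_invK.
Qed.

HB.instance Definition _ := hasSubgroupBasis.Build Sym
  sym_basis_nonempty sym_basis_subgroup sym_basisI sym_basisJ.

End SymmetricGroup.

Section Effros.
Context (T : topologicalType).

Record closed_subset := ClosedSubset {
  closed_subset_set :> set T;
  closed_subset_closed : closed closed_subset_set
}.

HB.instance Definition _ := gen_eqMixin closed_subset.
HB.instance Definition _ := gen_choiceMixin closed_subset.
HB.instance Definition _ := isPointed.Build closed_subset (ClosedSubset closed0).

Definition meeting (W : set T) : set closed_subset :=
  [set F : closed_subset | (F : set T) `&` W !=set0].

Definition effros : Type := g_sigma_algebraType [set meeting W | W in @open T].

HB.instance Definition _ := Measurable.on effros.

End Effros.

Record closed_subgroup := ClosedSubgroup {
  closed_subgroup_closed :> closed_subset Sym;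
  closed_subgroup_subgroup : is_subgroup closed_subgroup_closed
}.

HB.instance Definition _ := gen_eqMixin closed_subgroup.
HB.instance Definition _ := gen_choiceMixin closed_subgroup.

Lemma closed_Sym_subgroup : is_subgroup (ClosedSubset (@closedT Sym)).
Proof. by split. Qed.

HB.instance Definition _ :=
  isPointed.Build closed_subgroup (ClosedSubgroup closed_Sym_subgroup).

(* The closed subgroups carry the subspace sigma-algebra of the Effros space. *)
Definition to_effros (G : closed_subgroup) : effros Sym :=
  closed_subgroup_closed G.

HB.instance Definition _ :=
  Measurable.copy closed_subgroup (g_sigma_algebra_preimageType to_effros).

Lemma closed_subgroup_group_closed (G : closed_subgroup) :
  group_closed (mem (G : set Sym)).
Proof.
have [G1 GM GV] := closed_subgroup_subgroup G.
split; first exact/mem_set.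
by move=> x y /set_mem Gx /set_mem Gy; apply/mem_set/GM => //; exact: GV.
Qed.

Section ClosedSubgroupTopology.
Variable G : closed_subgroup.

HB.instance Definition _ := SubType.copy (set_type G) {x | x \in (G : set Sym)}.
HB.instance Definition _ := SubChoice_isSubGroup.Build Sym
  (fun x => x \in (G : set Sym)) (set_type G) (closed_subgroup_group_closed G).

Lemma closed_subgroup_mul_continuous :
  continuous (fun x : set_type G * set_type G => x.1 * x.2).
Proof.
apply: (@continuous_comp_initial _ _ _ (set_val : set_type G -> Sym)) => x.
apply: (@continuous_comp _ _ _
  (fun x : set_type G * set_type G => (set_val x.1, set_val x.2))
  (fun x : Sym * Sym => x.1 * x.2)); last exact: mulg_continuous.
have val_cont : continuous (set_val : set_type G -> Sym).
  exact: initial_continuous.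
case: x => x y A [[B C] [/= /val_cont nB /val_cont nC] BC].
exists (set_val @^-1` B, set_val @^-1` C) => //= -[u v] [/= Bu Cv].
exact: (BC (_, _)).
Qed.

Lemma closed_subgroup_inv_continuous :
  continuous (fun x : set_type G => x^-1).
Proof.
apply: (@continuous_comp_initial _ _ _ (set_val : set_type G -> Sym)) => x.
apply: (@continuous_comp _ _ _ (set_val : set_type G -> Sym)
  (fun x : Sym => x^-1)); last exact: invg_continuous.
exact: initial_continuous.
Qed.

HB.instance Definition _ := isTopologicalGroup.Build (set_type G)
  closed_subgroup_mul_continuous closed_subgroup_inv_continuous.

End ClosedSubgroupTopology.

Definition tuple_orbit (G : set Sym) n (t : n.-tuple nat) : set (n.-tuple nat) :=
  [set map_tuple g t | g in G].

Definition oligomorphic (G : closed_subgroup) : Prop :=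
  forall n, finite_set [set tuple_orbit G t | t in [set: n.-tuple nat]].

Definition quasi_oligomorphic (T : topologicalGroupType) : Prop :=
  exists2 G : closed_subgroup,
    oligomorphic G & topologically_isomorphic T (set_type G).

Definition open_subgroup_of (U G : closed_subgroup) : Prop :=
  U `<=` G /\ @open_subgroup (set_type G) (set_val @^-1` U).

Definition smooth (R : realType) d (X : measurableType d) (C : set X)
    (E : X -> X -> Prop) : Prop :=
  exists2 f : X -> R, measurable_fun C f &
    forall x y, C x -> C y -> (E x y <-> f x = f y).

Section PickingOpenSubgroups.
Variables (V : set closed_subgroup)
          (P : closed_subgroup -> closed_subgroup -> Prop).

Definition borel_relation_picking_open_subgroups : Prop :=
  measurable [set UG : closed_subgroup * closed_subgroup | P UG.1 UG.2] /\
  forall U G, P U G -> V G /\ open_subgroup_of U G.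

(* [U'] stands for the image of [U] under [phi], again a closed subgroup of Sym. *)
Definition invariant_relation : Prop :=
  forall (G H : closed_subgroup) (phi : set_type G -> set_type H),
    V G -> V H -> topological_isomorphism phi ->
    forall U U' : closed_subgroup,
      U `<=` G ->
      (U' : set Sym) = [set set_val (phi x) | x in set_val @^-1` (U : set Sym)] ->
      (P U G <-> P U' H).

(* The intersection is taken inside [G], so it is [G] for the empty family. *)
Definition sub_basic : Prop :=
  forall G, V G -> forall W : set (set_type G), open_subgroup W ->
    exists F : set closed_subgroup,
      [/\ finite_set F, forall U, F U -> P U G &
          \bigcap_(U in F) set_val @^-1` (U : set Sym) `<=` W].

Definition conjugacy_class (G U : set Sym) : set (set Sym) :=
  [set [set u ^ g | u in U] | g in G].

Definition finitely_many_conjugacy_classes (G : closed_subgroup) : Prop :=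
  finite_set [set conjugacy_class G U | U in [set U : closed_subgroup | P U G]].

End PickingOpenSubgroups.

(* Main.v *)
Require Import Defs.
From mathcomp Require Import all_boot all_order all_algebra.
From mathcomp Require Import all_classical all_reals all_analysis.
From mathcomp Require Import measurable_realfun lra.

(* For [G] in [V] let [D] be the set of left cosets of [P]-subgroups of [G], with
   the relations "some left translation maps [A_i] to [B_i] for all [i]". Every
   element of [D] is a set [p U q^-1] with [U] among finitely many subgroups, so
   conjugation by [G] has finitely many orbits on each [D^n]. Since the
   [P]-subgroups are sub-basic, [G] is a closed group of permutations of [D] by left
   translation, so a bijection [D_G -> D_H] preserving the relations conjugates
   [G] to [H], i.e. induces a topological isomorphism; a permutation of [D] that
   is locally induced by automorphisms is induced by one.
   (2) [Aut G] therefore acts on [D] as a closed group, with finitely many orbits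
   on [D^n] already for [Inn G].
   (3) Finiteness of the number of orbits of [Inn G] makes every ultrafilter on
   [Out G] converge by a back-and-forth argument. [Inn G] is closed because the
   normaliser of an open subgroup moves each of its fixed points to one of
   finitely many points.
   (1) By back and forth, the structures on [D_G] and [D_H] are isomorphic as soon
   as they satisfy the same first-order formulas. Open cosets have finite codes,
   so the satisfaction relation is Borel without a selection theorem. *)

Set Implicit Arguments.
Unset Strict Implicit.
Unset Printing Implicit Defensive.

Local Open Scope classical_set_scope.
Local Open Scope group_scope.

Lemma ex_choice (X Y : Type) (Q : X -> Y -> Prop) :
  (forall x, exists y, Q x y) -> exists f : X -> Y, forall x, Q x (f x).
Proof. by move=> /choice[f fP]; exists f. Qed.

(** * Closed permutation groups *)

Section Action.
Variable G : closed_subgroup.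
Implicit Types (x y : set_type G) (s : seq nat) (i : nat).

Definition gact x i : nat := sym_fun (set_val x) i.

Definition fixes x s : Prop := forall i, i \in s -> gact x i = i.

Lemma gactM x y i : gact (x * y) i = gact x (gact y i).
Proof. by []. Qed.

Lemma gactK x : cancel (gact x) (gact x^-1).
Proof. by move=> i; rewrite -gactM mulVg. Qed.

Lemma gactVK x : cancel (gact x^-1) (gact x).
Proof. by move=> i; rewrite -gactM mulgV. Qed.

Lemma gact_inj x : injective (gact x).
Proof. exact: can_inj (gactK x). Qed.

Lemma gact_ext x y : gact x =1 gact y -> x = y.
Proof. by move=> xy; apply: val_inj; apply: Sym_ext. Qed.

Lemma map_gactM x y s : map (gact (x * y)) s = map (gact x) (map (gact y) s).
Proof. by rewrite -map_comp. Qed.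

Lemma map_gact1 s : map (gact (1 : set_type G)) s = s.
Proof. by rewrite (@eq_map _ _ _ id) ?map_id. Qed.

Lemma map_gactK x s t : map (gact x) s = t -> map (gact x^-1) t = s.
Proof. by move=> <-; rewrite -map_gactM mulVg map_gact1. Qed.

Lemma fixesP x s : fixes x s <-> map (gact x) s = s.
Proof.
rewrite -[X in _ <-> _ = X]map_id.
by split=> [fx|E i si]; [apply/eq_in_map|have /eq_in_map/(_ i si) := E].
Qed.

Lemma fixes_cat x s t : fixes x (s ++ t) <-> fixes x s /\ fixes x t.
Proof.
split=> [f|[fs ft] i]; last by rewrite mem_cat => /orP[/fs|/ft].
by split=> i ii; apply: f; rewrite mem_cat ii ?orbT.
Qed.

Lemma fixesM x y s : fixes x s -> fixes y s -> fixes (x * y) s.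
Proof. by move=> fx fy i si; rewrite gactM fy// fx. Qed.

Lemma fixesV x s : fixes x s -> fixes x^-1 s.
Proof. by move=> fx i si; rewrite -{1}(fx i si) gactK. Qed.

Lemma fixes_map x y s :
  map (gact x) s = map (gact y) s -> fixes (x^-1 * y) s.
Proof. by move=> xy; apply/fixesP; rewrite map_gactM -xy; exact: map_gactK. Qed.

Lemma map_gact_fixes x y s : fixes y s -> map (gact (x * y)) s = map (gact x) s.
Proof. by move=> /fixesP fy; rewrite map_gactM fy. Qed.

Lemma fixes_conj x y s : fixes x (map (gact y) s) -> fixes (y^-1 * x * y) s.
Proof.
move=> fx i si; rewrite !gactM fx ?gactK//; exact: map_f.
Qed.

Lemma nbhs_Sym (f : Sym) (A : set Sym) : nbhs f A <->
  exists s : seq nat, forall h : Sym, (forall i, i \in s -> h i = f i) -> A h.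
Proof.
split.
  case=> _ [B /finite_seqP[s ->] ->] /= BA; exists s => h hf.
  have -> : h = f * (f^-1 * h) by rewrite mulgA mulgV mul1g.
  apply: BA => i /= si.
  by rewrite -[LHS]/((f^-1 : Sym) (h i)) hf// -[LHS]/((f^-1 * f) i) mulVg.
case=> s sA; exists (pointwise_stabilizer [set` s]); first by exists [set` s].
by move=> v /= Hv; apply: sA => i si; rewrite -[LHS]/(f (v i)) Hv.
Qed.

Lemma nbhs_gact x (A : set (set_type G)) : nbhs x A <->
  exists s, forall y, (forall i, i \in s -> gact y i = gact x i) -> A y.
Proof.
split.
  case=> [_ [[B oB <-] Bx] BA].
  have : nbhs (set_val x : Sym) B by exact: open_nbhs_nbhs.
  move=> /nbhs_Sym[s sB]; exists s => y Hy; apply: BA => /=; exact: sB.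
case=> s sA.
pose B := [set h : Sym | forall i, i \in s -> h i = (set_val x : Sym) i].
have nB : nbhs (set_val x : Sym) B by apply/nbhs_Sym; exists s.
have : nbhs x (set_val @^-1` B) by exact: (@initial_continuous _ _ (set_val : set_type G -> Sym)).
by apply: filterS => y /= By; exact: sA.
Qed.

Lemma open_gact (A : set (set_type G)) : open A <->
  forall x, A x -> exists s, forall y, fixes y s -> A (x * y).
Proof.
rewrite openE; split=> [oA x /oA /nbhs_gact[s sA]|oA x /oA [s sA]].
  by exists s => y fy; apply: sA => i si; rewrite gactM fy.
apply/nbhs_gact; exists s => y Hy.
have -> : y = x * (x^-1 * y) by rewrite mulgA mulgV mul1g.
by apply: sA => i si; rewrite gactM Hy// gactK.
Qed.

Lemma closed_gact (f : Sym) :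
  (forall s, exists x, forall i, i \in s -> gact x i = f i) ->
  exists x, set_val x = f.
Proof.
move=> Hf; suff Gf : (G : set Sym) f by exists (SigSub (mem_set Gf)).
apply: (@closed_subset_closed _ G f) => B /nbhs_Sym[s sB].
have [x xf] := Hf s; exists (set_val x); split; last exact: sB.
exact: set_mem (valP x).
Qed.

End Action.

Lemma continuous_morph (G H : closed_subgroup) (phi : set_type G -> set_type H) :
  {morph phi : x y / x * y} ->
  (forall t, exists s, forall x, fixes x s -> fixes (phi x) t) ->
  continuous phi.
Proof.
move=> phiM Hc x A /nbhs_gact[t tA]; have [s Hs] := Hc t.
apply/nbhs_gact; exists s => y Hy /=; apply: tA => i ti.
have -> : y = x * (x^-1 * y) by rewrite mulgA mulgV mul1g.
rewrite phiM gactM (Hs (x^-1 * y))//.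
by move=> j sj; rewrite gactM Hy// gactK.
Qed.

(** * Back and forth *)

Section BackAndForth.
Variables (X Y : pointedType) (D : set X) (E : set Y).
Variables (eX : nat -> X) (eY : nat -> Y) (R : seq (X * Y) -> Prop).
Hypothesis D_enum : forall x, D x -> exists n, eX n = x.
Hypothesis E_enum : forall y, E y -> exists n, eY n = y.
Hypothesis R0 : R [::].
Hypothesis forth : forall s x, R s -> D x -> exists2 y, E y & R ((x, y) :: s).
Hypothesis back : forall s y, R s -> E y -> exists2 x, D x & R ((x, y) :: s).
Hypothesis R_inj : forall s p q, R s -> p \in s -> q \in s ->
  p.1 = q.1 <-> p.2 = q.2.

(** Alternating forth and back steps along the enumerations give an increasing chain [S n] in [R]
    whose union is a bijection. A sublist of a member of [R] may lie outside [R], so the last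
    conclusion places each finite piece of the graph of [f] inside a member of [R]. *)
Lemma back_and_forth : exists (f : X -> Y) (g : Y -> X),
  [/\ forall x, D x -> E (f x) /\ g (f x) = x,
      forall y, E y -> D (g y) /\ f (g y) = y &
      forall l : seq X, (forall x, x \in l -> D x) ->
        exists2 s, R s & forall x, x \in l -> (x, f x) \in s].
Proof.
have H1 (p : seq (X * Y) * X) : exists y,
    R p.1 -> D p.2 -> E y /\ R ((p.2, y) :: p.1).
  have [[Rs Dx]|N] := pselect (R p.1 /\ D p.2).
    by have [y Ey Ry] := forth Rs Dx; exists y.
  by exists point => Rs Dx; case: N.
have [F FP] := ex_choice H1.
have H2 (p : seq (X * Y) * Y) : exists x,
    R p.1 -> E p.2 -> D x /\ R ((x, p.2) :: p.1).
  have [[Rs Ey]|N] := pselect (R p.1 /\ E p.2).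
    by have [x Dx Rx] := back Rs Ey; exists x.
  by exists point => Rs Dx; case: N.
have [K KP] := ex_choice H2.
pose fstep n s := if `[< D (eX n) >] then (eX n, F (s, eX n)) :: s else s.
pose bstep n s := if `[< E (eY n) >] then (K (s, eY n), eY n) :: s else s.
pose S := fix S n := if n is m.+1 then bstep m (fstep m (S m)) else [::].
have RF n s : R s -> R (fstep n s).
  by move=> Rs; rewrite /fstep; case: asboolP => // /(FP (_, _) Rs)[].
have RB n s : R s -> R (bstep n s).
  by move=> Rs; rewrite /bstep; case: asboolP => // /(KP (_, _) Rs)[].
have RS n : R (S n) by elim: n => //= n IH; exact/RB/RF.
have FS n s : {subset s <= fstep n s}.
  by move=> p sp; rewrite /fstep; case: ifP; rewrite ?inE ?sp ?orbT.
have BS n s : {subset s <= bstep n s}.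
  by move=> p sp; rewrite /bstep; case: ifP; rewrite ?inE ?sp ?orbT.
have S_mono m n : (m <= n)%N -> {subset S m <= S n}.
  move=> /subnK <-; elim: (n - m)%N => // k IH p /IH Sp.
  by rewrite addSn /=; apply/BS/FS.
have SDE n p : p \in S n -> D p.1 /\ E p.2.
  elim: n => //= n IH; rewrite /bstep; set s := fstep n _.
  have Hs : p \in s -> D p.1 /\ E p.2.
    rewrite /s /fstep; case: asboolP => // Dn; rewrite inE => /orP[/eqP -> /=|//].
    by split=> //; have [] := FP (_, _) (RS n) Dn.
  case: asboolP => // En; rewrite inE => /orP[/eqP -> /=|//].
  by split=> //; have [] := KP (_, _) (RF n _ (RS n)) En.
have SD x : D x -> exists n y, (x, y) \in S n.
  move=> Dx; have [n en] := D_enum Dx; exists n.+1, (F (S n, x)).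
  by apply: BS; rewrite /fstep en asboolT// inE eqxx.
have SE y : E y -> exists n x, (x, y) \in S n.
  move=> Ey; have [n en] := E_enum Ey; exists n.+1, (K (fstep n (S n), y)).
  by rewrite /= /bstep en asboolT// inE eqxx.
have Hf x : exists y, D x -> exists n, (x, y) \in S n.
  have [Dx|N] := pselect (D x); last by exists point.
  by have [n [y ?]] := SD x Dx; exists y => _; exists n.
have Hg y : exists x, E y -> exists n, (x, y) \in S n.
  have [Dx|N] := pselect (E y); last by exists point.
  by have [n [x ?]] := SE y Dx; exists x => _; exists n.
have Sinj m n p q : p \in S m -> q \in S n -> p.1 = q.1 <-> p.2 = q.2.
  move=> /(S_mono _ _ (leq_maxl m n)) pS /(S_mono _ _ (leq_maxr m n)).
  exact: R_inj pS.
have [f fP] := ex_choice Hf.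
have [g gP] := ex_choice Hg.
exists f, g; split.
- move=> x Dx; have [n xn] := fP x Dx; have [_ /= Ef] := SDE _ _ xn.
  split=> //; have [m gm] := gP _ Ef.
  by have [_ /(_ erefl)] := Sinj _ _ _ _ gm xn.
- move=> y Ey; have [n yn] := gP y Ey; have [/= Dg _] := SDE _ _ yn.
  split=> //; have [m fm] := fP _ Dg.
  by have [/(_ erefl)] := Sinj _ _ _ _ fm yn.
- move=> l Dl; suff [n Hn] : exists n, forall x, x \in l -> (x, f x) \in S n.
    by exists (S n).
  elim: l Dl => [|x l IH] Dl; first by exists 0%N.
  have [|n Hn] := IH; first by move=> z zl; apply: Dl; rewrite inE zl orbT.
  have [|m Hm] := fP x; first by apply: Dl; rewrite inE eqxx.
  exists (maxn m n) => z; rewrite inE => /orP[/eqP ->|/Hn].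
    exact: S_mono (leq_maxl _ _) _ Hm.
  exact: S_mono (leq_maxr _ _) _.
Qed.

End BackAndForth.

(** * Permutations approximated by elements of a closed group *)

Section ClosedImage.
Variables (G : closed_subgroup) (X : pointedType) (act : set_type G -> X -> X).
Variables (D : set X) (sigma : X -> X).
Hypothesis actM : forall x y d, act (x * y) d = act x (act y d).
Hypothesis act1 : forall d, act 1 d = d.
Hypothesis act_cont : forall d, D d ->
  exists s, forall x, fixes x s -> act x d = d.
Hypothesis act_fin : forall u : nat, exists2 l : seq X,
  forall d, d \in l -> D d &
  finite_set [set gact x u | x in
    [set x : set_type G | forall d, d \in l -> act x d = d]].
Hypothesis sigma_surj : forall d, D d -> exists2 e, D e & sigma e = d.
Hypothesis sigma_local : forall l : seq X, (forall d, d \in l -> D d) ->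
  exists x, forall d, d \in l -> act x d = sigma d.

Let R (s : seq (nat * nat)) : Prop :=
  forall l : seq X, (forall d, d \in l -> D d) ->
  exists2 x : set_type G, forall p, p \in s -> gact x p.1 = p.2 &
    forall d, d \in l -> act x d = sigma d.

(** If every candidate failed, each of the finitely many [v] in [Z] would be refuted by a finite
    list; an element agreeing with [sigma] on all these lists at once takes one of the values in
    [Z], a contradiction. [q] covers both extension directions. *)
Let R_ext s (l : seq X) (q : nat -> nat * nat) (Z : set nat) :
  R s -> (forall d, d \in l -> D d) -> finite_set Z ->
  (forall x : set_type G, (forall d, d \in l -> act x d = sigma d) ->
     exists2 v, Z v & gact x (q v).1 = (q v).2) ->
  exists v, R (q v :: s).
Proof.
move=> Rs Dl /finite_seqP[zs Zzs] HZ.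
have [//|N] := pselect (exists v, R (q v :: s)).
have H v : exists l' : seq X, (forall d, d \in l' -> D d) /\
    ~ (exists2 x : set_type G, forall p, p \in q v :: s -> gact x p.1 = p.2 &
    forall d, d \in l' -> act x d = sigma d).
  apply: contrapT => H; apply: N; exists v => l' Dl'.
  by apply: contrapT => H'; apply: H; exists l'.
have [lv lvP] := ex_choice H.
have [|x xs xL] := Rs (l ++ flatten [seq lv v | v <- zs]).
  move=> d; rewrite mem_cat => /orP[/Dl//|/flattenP[_ /mapP[v _ ->]]].
  exact: (lvP v).1.
have [|v Zv xv] := HZ x; first by move=> d dl; apply: xL; rewrite mem_cat dl.
case: (lvP v).2; exists x => [p|d dl].
  by rewrite inE => /orP[/eqP ->|/xs].
apply: xL; rewrite mem_cat; apply/orP; right; apply/flattenP.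
exists (lv v) => //; apply: map_f.
by move: Zv; rewrite Zzs.
Qed.

(* Back and forth on the points of [nat]: by [act_fin], an element of the group
   that agrees with [sigma] on a suitable finite list has only finitely many
   possible values at a given point, so one value works for all finite lists. *)
Lemma closed_image : exists x : set_type G, forall d, D d -> act x d = sigma d.
Proof.
have actK (x : set_type G) d : act x^-1 (act x d) = d.
  by rewrite -actM mulVg act1.
have forth s u : R s -> setT u -> exists2 v, setT v & R ((u, v) :: s).
  move=> Rs _; have [l Dl fl] := act_fin u.
  have [x0 _ x0l] := Rs l Dl.
  have [|v Rv] := @R_ext s l (fun v => (u, v)) _ Rs Dl
    (finite_image (gact x0) fl); last by exists v.
  move=> x xl; exists (gact x u) => //=.
  exists (gact (x0^-1 * x) u); last by rewrite gactM gactVK.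
  exists (x0^-1 * x) => // d dl /=.
  by rewrite actM xl// -x0l// actK.
have H d : exists e, D d -> D e /\ sigma e = d.
  have [Dd|Nd] := pselect (D d); last by exists point.
  by have [e De ed] := sigma_surj Dd; exists e.
have [tau tauP] := ex_choice H.
have back s v : R s -> setT v -> exists2 u, setT u & R ((u, v) :: s).
  move=> Rs _; have [l1 Dl1 fl1] := act_fin v.
  (* Going back, [x^-1] must have finitely many values at [v]. If [x] and [x0] both agree with
     [sigma] on the [sigma]-preimages of [l1], then [x0 * x^-1] fixes every element of [l1]. *)
  pose l := map tau l1.
  have Dl d : d \in l -> D d by move=> /mapP[e /Dl1 De ->]; exact: (tauP _ De).1.
  have [x0 _ x0l] := Rs l Dl.
  have [|u Ru] := @R_ext s l (fun u => (u, v)) _ Rs Dl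
    (finite_image (gact x0^-1) fl1); last by exists u.
  move=> x xl; exists (gact x^-1 v) => /=; last by rewrite gactVK.
  exists (gact (x0 * x^-1) v); last by rewrite gactM gactK.
  exists (x0 * x^-1) => // d dl /=.
  have [_ td] := tauP _ (Dl1 _ dl).
  have tl : tau d \in l by exact: map_f.
  by rewrite actM -[in LHS]td -xl// actK x0l.
have R_inj s p q : R s -> p \in s -> q \in s -> p.1 = q.1 <-> p.2 = q.2.
  move=> Rs ps qs; have [|x xs _] := Rs [::]; first by [].
  rewrite -(xs _ ps) -(xs _ qs); split=> [->//|]; exact: gact_inj.
have R0 : R [::] by move=> l /sigma_local[x xl]; exists x.
have enum (u : nat) : setT u -> exists n, id n = u by exists u.
have [f [g [fP gP fR]]] := back_and_forth enum enum R0 forth back R_inj.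
have bij_f : bijective f.
  by exists g => u; [case: (fP u)|case: (gP u)].
have [|x xf] := @closed_gact G (MkSym bij_f).
  move=> s; have [|r Rr sr] := fR s; first by [].
  have [|x xr _] := Rr [::]; first by [].
  by exists x => i /sr /xr.
(* Some [y] agrees with the permutation [x] on [s] and with [sigma] at [d]; then [x^-1 * y] fixes
   [s], hence [d]. *)
exists x => d Dd; have [s sd] := act_cont Dd.
have [|r Rr sr] := fR s; first by [].
have [|y yr yd] := Rr [:: d]; first by move=> e; rewrite inE => /eqP ->.
rewrite -yd ?inE//.
have -> : y = x * (x^-1 * y) by rewrite mulgA mulgV mul1g.
rewrite actM; congr (act x _); apply/esym/sd => i si; rewrite gactM (yr _ (sr _ si))/=.
have -> : f i = gact x i by rewrite /gact xf.
exact: gactK.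
Qed.

End ClosedImage.

(** * Finiteness in oligomorphic groups *)

(** [Q x c] makes [c] a label of [x], possibly one of several; one element of [S] is kept for each
    label of [L] that occurs. *)
Lemma finite_reps (X C : eqType) (S : set X) (Q : X -> C -> Prop) (L : seq C) :
  (forall x, S x -> exists2 c, c \in L & Q x c) ->
  exists2 r : seq X, forall x, x \in r -> S x &
    forall x, S x -> exists2 y, y \in r & exists2 c, Q x c & Q y c.
Proof.
move=> HL.
have [r [rS rP]] : exists r : seq X, (forall x, x \in r -> S x) /\
    forall x c, S x -> c \in L -> Q x c -> exists2 y, y \in r & Q y c.
  elim: L {HL} => [|c L [r [rS rP]]]; first by exists [::].
  have [[x [Sx Qx]]|N] := pselect (exists x, S x /\ Q x c).
    exists (x :: r); split=> [y|y d Sy].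
      by rewrite inE => /orP[/eqP ->|/rS].
    rewrite inE => /orP[/eqP -> _|dL /(rP _ _ Sy dL)[z zr Qz]].
      by exists x; rewrite ?inE ?eqxx.
    by exists z; rewrite // inE zr orbT.
  exists r; split=> // y d Sy; rewrite inE => /orP[/eqP -> Qy|]; last exact: rP.
  by case: N; exists y.
exists r => // x Sx; have [c cL Qc] := HL x Sx.
by have [y yr Qy] := rP x c Sx cL Qc; exists y => //; exists c.
Qed.

Definition orb (G : closed_subgroup) (s t : seq nat) : Prop :=
  exists x : set_type G, map (gact x) s = t.

Lemma orb_sym G s t : orb G s t -> orb G t s.
Proof. by case=> x xs; exists x^-1; exact: map_gactK. Qed.

Lemma orb_trans G s t u : orb G s t -> orb G t u -> orb G s u.
Proof. by case=> x <- [y <-]; exists (y * x); rewrite map_gactM. Qed.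

Section Oligomorphic.
Variable G : closed_subgroup.
Hypothesis G_olig : oligomorphic G.

Lemma oligomorphic_orb n : exists L : seq (seq nat),
  forall t, size t = n -> exists2 t0, t0 \in L & orb G t0 t.
Proof.
have /finite_seqP[os osP] := G_olig n.
have [|r rS rP] := @finite_reps (n.-tuple nat) _ setT
  (fun t o => o = tuple_orbit G t) os.
  move=> t _; exists (tuple_orbit G t) => //.
  suff : [set` os] (tuple_orbit G t) by [].
  by rewrite -osP; exists t.
exists (map val r) => t /eqP st; have [y yr [c -> oy]] := rP (Tuple st) I.
exists (val y); first exact: map_f.
have : tuple_orbit G (Tuple st) (Tuple st).
  exists 1; first by case: (closed_subgroup_subgroup G).
  by apply: val_inj; rewrite /= -[RHS]map_id.
rewrite oy => -[g Gg gy]; exists (SigSub (mem_set Gg) : set_type G).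
exact: (congr1 val gy).
Qed.

(** Fixed points [v] and [w] with [v :: s] and [w :: s] in one orbit are equal, since the element
    moving one tuple to the other fixes [s] and hence [v]. So orbits bound the number of fixed
    points. *)
Lemma finite_fixed_points s : exists L : seq nat, forall v,
  (forall x : set_type G, fixes x s -> gact x v = v) -> v \in L.
Proof.
have [L LP] := oligomorphic_orb (size s).+1.
have [|r _ rP] := @finite_reps nat _
  [set v | forall x : set_type G, fixes x s -> gact x v = v]
  (fun v c => orb G c (v :: s)) L.
  by move=> v _; exact: LP.
exists r => v fv; have [w wr [c cv cw]] := rP v fv.
have [x /= [xv /fixesP xs]] := orb_trans (orb_sym cv) cw.
by rewrite -(fv x xs) xv.
Qed.

(** The double coset of [x] is determined by the orbit of the pair of [s] and [x s]: an [h] moving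
    the pair of [y] to that of [x] fixes [s], and so does [(h * y)^-1 * x]. *)
Lemma finite_double_cosets s (S : set (set_type G)) :
  exists2 r : seq (set_type G), forall x, x \in r -> S x &
    forall x, S x -> exists2 y, y \in r &
      exists h k, [/\ fixes h s, fixes k s & x = h * y * k].
Proof.
have [L LP] := oligomorphic_orb (size s + size s).
have [|r rS rP] := @finite_reps _ _ S
  (fun x c => orb G c (s ++ map (gact x) s)) L.
  by move=> x _; apply: LP; rewrite size_cat size_map.
exists r => // x /rP[y yr [c cx cy]]; exists y => //.
have [h] := orb_trans (orb_sym cy) cx; rewrite map_cat => /eqP.
rewrite eqseq_cat ?size_map// => /andP[/eqP/fixesP hs /eqP hy].
exists h, ((h * y)^-1 * x); split=> //.
  by apply: fixes_map; rewrite map_gactM hy.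
by rewrite mulgA mulgV mul1g.
Qed.

End Oligomorphic.

(** * Cosets of a basis of open subgroups *)

Section Translates.
Variable gT : groupType.
Implicit Types (x y z : gT) (A W : set gT).

(** Translates [x A], and below conjugates [x A x^-1], are written as preimages, so that membership
    unfolds without an existential. *)
Definition lcos x A : set gT := [set y | A (x^-1 * y)].
Definition cjs x A : set gT := [set y | A (x^-1 * y * x)].

Lemma lcosE x A : lcos x A = [set x * u | u in A].
Proof.
apply/seteqP; split=> y /=; last by case=> u Au <-; rewrite /lcos/= mulKg.
by move=> Ay; exists (x^-1 * y); rewrite // mulVKg.
Qed.

Lemma cjsE x A : cjs x A = [set u ^ x^-1 | u in A].
Proof.
apply/seteqP; split=> y /=.
  move=> Ay; exists (x^-1 * y * x) => //.
  by rewrite /conjg invgK !mulgA mulgV mul1g mulgK.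
by case=> u Au <-; rewrite /cjs/= /conjg invgK !mulgA mulVg mul1g mulgVK.
Qed.

Lemma lcosM x y A : lcos (x * y) A = lcos x (lcos y A).
Proof. by apply/seteqP; split=> z; rewrite /lcos/= invgM !mulgA. Qed.

Lemma lcos1 A : lcos 1 A = A.
Proof. by apply/seteqP; split=> z; rewrite /lcos/= invg1 mul1g. Qed.

Lemma lcosK x A : lcos x^-1 (lcos x A) = A.
Proof. by rewrite -lcosM mulVg lcos1. Qed.

Lemma cjsM x y A : cjs (x * y) A = cjs x (cjs y A).
Proof. by apply/seteqP; split=> z; rewrite /cjs/= invgM !mulgA. Qed.

Lemma cjs1 A : cjs 1 A = A.
Proof. by apply/seteqP; split=> z; rewrite /cjs/= invg1 mul1g mulg1. Qed.

Lemma cjsK x A : cjs x^-1 (cjs x A) = A.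
Proof. by rewrite -cjsM mulVg cjs1. Qed.

Lemma subgroupMl W x y : is_subgroup W -> W x -> W (x * y) <-> W y.
Proof.
case=> W1 WM WV Wx; split=> [Wxy|]; last exact: WM.
by rewrite -(mulKg x y); apply: WM => //; exact: WV.
Qed.

Lemma subgroupMr W x y : is_subgroup W -> W x -> W (y * x) <-> W y.
Proof.
case=> W1 WM WV Wx; split=> [Wxy|Wy]; last exact: WM.
by rewrite -(mulgK x y); apply: WM => //; exact: WV.
Qed.

Lemma lcos_stab W x y : is_subgroup W ->
  lcos y (lcos x W) = lcos x W <-> W (x^-1 * y * x).
Proof.
move=> sW; have [W1 WM WV] := sW.
split=> [E|Wy].
  have : lcos y (lcos x W) (y * x) by rewrite /lcos/= !mulgA mulgVK mulVg.
  by rewrite E /lcos/= mulgA.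
apply/seteqP; split=> z; rewrite /lcos/=.
  by move=> Wz; have := WM _ _ Wy Wz; rewrite !mulgA mulgK mulgK.
by move=> Wz; have := WM _ _ (WV _ Wy) Wz; rewrite !invgM invgK !mulgA mulgK.
Qed.

Lemma lcos_mem W x y : is_subgroup W -> lcos x W y -> lcos x W = lcos y W.
Proof.
move=> sW; rewrite /lcos/= => Wxy; apply/seteqP; split=> z /=.
  move=> Wz; apply/(subgroupMl _ sW Wxy).
  by rewrite mulgA mulgK.
by move=> Wz; have /(subgroupMl _ sW Wxy) := Wz; rewrite mulgA mulgK.
Qed.

End Translates.

(* What the argument uses of the system [F] of all [P]-subgroups of a group in [V]. *)
Record coset_basis (G : closed_subgroup) (F : set (set (set_type G))) : Prop := {
  cb_sub : forall W, F W -> is_subgroup W;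
  cb_open : forall W, F W -> exists s, forall x, fixes x s -> W x;
  cb_conj : forall x W, F W -> F (cjs x W);
  cb_fin : exists2 r : seq (set (set_type G)), forall W, W \in r -> F W &
    forall W, F W -> exists2 W0, W0 \in r & exists x, W = cjs x W0;
  cb_basic : forall s, exists2 l : seq (set (set_type G)),
    forall U, U \in l -> F U &
    forall x, (forall U, U \in l -> U x) -> fixes x s
}.

Definition cosets (G : closed_subgroup) (F : set (set (set_type G))) :
  set (set (set_type G)) := [set A | exists W x, F W /\ A = lcos x W].

Lemma finite_seqs (X : eqType) (r : seq X) n : exists L : seq (seq X),
  forall t, size t = n -> {subset t <= r} -> t \in L.
Proof.
elim: n => [|n [L HL]].
  by exists [:: [::]] => t /size0nil ->; rewrite inE.
exists [seq x :: t | x <- r, t <- L] => -[//|x t] /= [st] tr.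
apply: allpairs_f; first by apply: tr; rewrite inE eqxx.
by apply: HL => // y yt; apply: tr; rewrite inE yt orbT.
Qed.

Section CosetBasis.
Variables (G : closed_subgroup) (F : set (set (set_type G))).
Hypothesis FB : coset_basis F.
Local Notation D := (cosets F).

Lemma fam_cosets U : F U -> D U.
Proof. by move=> FU; exists U, 1; rewrite lcos1. Qed.

Lemma cosets_lcos x A : D A -> D (lcos x A).
Proof. by case=> W [y [FW ->]]; exists W, (x * y); rewrite lcosM. Qed.

Lemma cosets_faithful x y : (forall U, F U -> lcos x U = lcos y U) -> x = y.
Proof.
move=> xy; apply: gact_ext => i.
have [l lF /(_ (x^-1 * y)) fl] := cb_basic FB [:: i].
suff : gact (x^-1 * y) i = i by rewrite gactM => E; rewrite -{1}E gactVK.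
apply: fl (mem_head _ _) => U /lF FU.
have [U1 _ _] := cb_sub FB FU.
have : lcos y U y by rewrite /lcos/= mulVg.
by rewrite -xy.
Qed.

Lemma lcos_cont A : D A -> exists s, forall x, fixes x s -> lcos x A = A.
Proof.
case=> W [y [FW ->]]; have [s sW] := cb_open FB FW.
exists (map (gact y) s) => x fx; apply/lcos_stab; first exact: cb_sub FW.
exact/sW/fixes_conj.
Qed.

Lemma cjs_cont A : D A -> exists s, forall x, fixes x s -> cjs x A = A.
Proof.
case=> W [y [FW ->]]; have [s sW] := cb_open FB FW.
have sgW := cb_sub FB FW.
exists (s ++ map (gact y) s) => x /fixes_cat[/sW fx /fixes_conj/sW fy].
apply/seteqP; split=> z; rewrite /cjs /lcos/= ?mulgA.
  move/(subgroupMr _ sgW fx)/(subgroupMl _ sgW fy).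
  by rewrite !mulgA mulgK mulgK.
move=> Wz; apply/(subgroupMr _ sgW fx)/(subgroupMl _ sgW fy).
by rewrite !mulgA mulgK mulgK.
Qed.

(** Hypothesis [act_fin] of [closed_image] for left translation: an element fixing each listed
    subgroup lies in all of them, hence fixes [u]. *)
Lemma lcos_fin (u : nat) : exists2 l : seq (set (set_type G)),
  forall d, d \in l -> D d &
  finite_set [set gact x u | x in
    [set x : set_type G | forall d, d \in l -> lcos x d = d]].
Proof.
have [l lF lu] := cb_basic FB [:: u].
exists l; first by move=> d /lF /fam_cosets.
apply: (@sub_finite_set _ _ [set u]) => // _ [x /= xl <-].
apply: lu (mem_head _ _) => U Ul; have sU := cb_sub FB (lF _ Ul).
rewrite -[x]mulg1 -[x * 1]mul1g -{1}invg1 mulgA; apply/lcos_stab => //.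
by rewrite lcos1; exact: xl.
Qed.

Hypothesis G_olig : oligomorphic G.

(* Up to conjugation, a list of cosets [p U q^-1] with [U] one of finitely many
   subgroups depends only on the values of the [p] and [q] at finitely many points. *)
Lemma finite_conjugation_orbits n : exists2 r : seq (seq (set (set_type G))),
  forall As, As \in r -> forall A, A \in As -> D A &
  forall As, size As = n -> (forall A, A \in As -> D A) ->
    exists2 Bs, Bs \in r & exists x, As = map (cjs x) Bs.
Proof.
have [r0 r0F r0P] := cb_fin FB.
have [s0 s0P] : exists s, forall W, W \in r0 -> forall x, fixes x s -> W x.
  elim: r0 r0F {r0P} => [|W r IH] rF; first by exists [::].
  have [|s sP] := IH; first by move=> U Ur; apply: rF; rewrite inE Ur orbT.
  have [|t tP] := cb_open FB (rF W _); first by rewrite inE eqxx.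
  exists (s ++ t) => U + x /fixes_cat[fs ft].
  by rewrite inE => /orP[/eqP ->|/sP]; [exact: tP|exact].
(* [dc (U, (p, q))] is [p U q^-1]. A coset [x (y W0 y^-1)] has this form with [p = x y] and
   [q = y]. *)
pose dc (L : set (set_type G) * (set_type G * set_type G)) : set (set_type G) :=
  [set y | L.1 (L.2.1^-1 * y * L.2.2)].
have dcP A : D A -> exists2 L, L.1 \in r0 & dc L = A.
  case=> W [x [/r0P[W0 W0r [y ->]] ->]].
  exists (W0, (x * y, y)) => //; apply/seteqP.
  by split=> z; rewrite /dc /lcos /cjs/= invgM !mulgA.
pose pts (L : seq (set (set_type G) * (set_type G * set_type G))) :=
  flatten [seq map (gact l.2.1) s0 ++ map (gact l.2.2) s0 | l <- L].
have ptsS L : size (pts L) = (size L * (size s0 + size s0))%N.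
  by elim: L => //= l L IH; rewrite /pts/= !size_cat !size_map -/(pts L) IH.
(* The label of a list consists of the subgroups used and the orbit of the tuple of values of all
   [p] and [q] on [s0]; finitely many labels suffice. *)
pose Q (As : seq (set (set_type G))) (c : seq (set (set_type G)) * seq nat) :=
  exists L, [/\ {subset map fst L <= r0}, map dc L = As, map fst L = c.1 &
    orb G c.2 (pts L)].
have [C1 C1P] := finite_seqs r0 n.
have [C2 C2P] := oligomorphic_orb G_olig (n * (size s0 + size s0)).
have [|r rS rP] := @finite_reps _ _
  [set As | size As = n /\ forall A, A \in As -> D A] Q [seq (a, b) | a <- C1, b <- C2].
  move=> As [sAs AsD].
  have [L [Lr LA]] : exists L, {subset map fst L <= r0} /\ map dc L = As.
    elim: As AsD {sAs} => [|A As IH] AsD; first by exists [::].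
    have [|L [Lr LA]] := IH; first by move=> B Bs; apply: AsD; rewrite inE Bs orbT.
    have [|l lr lA] := dcP A; first by apply: AsD; rewrite inE eqxx.
    exists (l :: L); rewrite /= LA lA; split=> // W; rewrite inE.
    by move=> /orP[/eqP ->|/Lr].
  have sL : size L = n by rewrite -sAs -LA size_map.
  have [|t tC tL] := C2P (pts L); first by rewrite ptsS sL.
  exists (map fst L, t); last by exists L.
  by apply: allpairs_f => //; apply: C1P; rewrite ?size_map.
exists r => [As /rS[]//|As sAs AsD].
have [Bs Br [c [L [Lr <- Lc cL]] [M [_ MB Mc cM]]]] := rP As (conj sAs AsD).
exists Bs => //; have [k kML] := orb_trans (orb_sym cM) cL.
(* [k] carries the values of [p'] and [q'] on [s0] to those of [p] and [q], so [k p'] and [p] differ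
   by an element of [W], as do [k q'] and [q]. Hence [k (p' W q'^-1) k^-1 = p W q^-1]. *)
exists k; rewrite -MB; have : map fst M = map fst L by rewrite Mc Lc.
elim: L M Lr kML {Lc Mc cL cM MB rP AsD sAs} => [|[W [p q]] L IH] [|[W' [p' q']] M] //= Lr.
move=> + [EW EM]; rewrite /pts/= -/(pts L) -/(pts M) !map_cat => /eqP.
rewrite !eqseq_cat ?size_cat ?size_map// => /andP[/andP[/eqP kp /eqP kq] /eqP kLM].
subst W'; congr cons; last first.
  by apply: IH => // U UL; apply: Lr; rewrite inE UL orbT.
have Wr : W \in r0 by apply: Lr; rewrite inE eqxx.
have sW := cb_sub FB (r0F _ Wr).
have Wp : W (p^-1 * (k * p')).
  by apply: (s0P W Wr); apply: fixes_map; rewrite map_gactM kp.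
have Wq : W ((k * q')^-1 * q).
  by apply: (s0P W Wr); apply: fixes_map; rewrite map_gactM kq.
apply/seteqP; split=> z; rewrite /dc /cjs/= => Wz.
  have /(subgroupMr _ sW Wq) :
      W (p^-1 * (k * p') * (p'^-1 * (k^-1 * z * k) * q') * ((k * q')^-1 * q)).
    by rewrite !(mulgA, invgM, mulgK, mulgVK).
  by move/(subgroupMl _ sW Wp).
have : W (p^-1 * (k * p') * (p'^-1 * (k^-1 * z * k) * q') * ((k * q')^-1 * q)).
  by apply/subgroupMr => //; apply/subgroupMl.
by rewrite !(mulgA, invgM, mulgK, mulgVK).
Qed.

End CosetBasis.

(** * Isomorphisms of coset structures *)

Section ImagesOfTranslates.
Variables (gT hT : groupType) (phi : gT -> hT) (psi : hT -> gT).
Hypotheses (phiM : {morph phi : x y / x * y}).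
Hypotheses (phiK : cancel phi psi) (psiK : cancel psi phi).

Lemma image_can A : phi @` A = psi @^-1` A.
Proof.
apply/seteqP; split=> y /=; first by case=> x Ax <-; rewrite phiK.
by move=> Ay; exists (psi y).
Qed.

Lemma can_morph : {morph psi : x y / x * y}.
Proof. by move=> x y; apply: (can_inj phiK); rewrite phiM !psiK. Qed.

Lemma morph_1 : phi 1 = 1.
Proof. by apply: (@mulgI _ (phi 1)); rewrite -phiM !mulg1. Qed.

Lemma morph_V x : phi x^-1 = (phi x)^-1.
Proof. by apply: (@mulgI _ (phi x)); rewrite -phiM !mulgV morph_1. Qed.

Lemma image_imageK A : psi @` (phi @` A) = A.
Proof.
rewrite image_comp (_ : psi \o phi = id) ?image_id//.
by apply/funext => x /=; exact: phiK.
Qed.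

Lemma image_lcos x A : phi @` lcos x A = lcos (phi x) (phi @` A).
Proof.
rewrite !lcosE; apply/seteqP; split=> z /=.
  by case=> _ [u Au <-] <-; exists (phi u); rewrite ?phiM//; exists u.
by case=> _ [u Au <-] <-; exists (x * u); rewrite ?phiM//; exists u.
Qed.

Lemma is_subgroup_image A : is_subgroup A -> is_subgroup (phi @` A).
Proof.
case=> A1 AM AV; split.
- by exists 1 => //; exact: morph_1.
- by move=> _ _ [x Ax <-] [y Ay <-]; exists (x * y); [exact: AM|exact: phiM].
- by move=> _ [x Ax <-]; exists x^-1; [exact: AV|exact: morph_V].
Qed.

End ImagesOfTranslates.

Lemma fixes_collect (G : closed_subgroup) (X : eqType) (l : seq X)
    (Q : set_type G -> X -> Prop) :
  (forall d, d \in l -> exists s, forall x, fixes x s -> Q x d) ->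
  exists s, forall x, fixes x s -> forall d, d \in l -> Q x d.
Proof.
elim: l => [|d l IH] lQ; first by exists [::].
have [|s sP] := IH; first by move=> e el; apply: lQ; rewrite inE el orbT.
have [|t tP] := lQ d; first by rewrite inE eqxx.
exists (s ++ t) => x /fixes_cat[fs ft] e.
by rewrite inE => /orP[/eqP ->|/(sP _ fs)//]; exact: tP.
Qed.

(** Preservation of the translation relations in both directions; the translating element may vary
    with the finite list. *)
Record coset_iso (G H : closed_subgroup) (F : set (set (set_type G)))
    (F' : set (set (set_type H))) (f : set (set_type G) -> set (set_type H))
    (g : set (set_type H) -> set (set_type G)) : Prop := {
  ci_f : forall A, cosets F A -> cosets F' (f A) /\ g (f A) = A;
  ci_g : forall B, cosets F' B -> cosets F (g B) /\ f (g B) = B;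
  ci_f_lcos : forall (l : seq (set (set_type G))) x, (forall A, A \in l -> cosets F A) ->
    exists y, forall A, A \in l -> f (lcos x A) = lcos y (f A);
  ci_g_lcos : forall (l : seq (set (set_type H))) y, (forall B, B \in l -> cosets F' B) ->
    exists x, forall B, B \in l -> g (lcos y B) = lcos x (g B)
}.

Lemma coset_iso_sym (G H : closed_subgroup) (F : set (set (set_type G)))
    (F' : set (set (set_type H)))  f g : coset_iso F F' f g -> coset_iso F' F g f.
Proof. by case. Qed.

Section CosetIso.
Variables (G H : closed_subgroup) (F : set (set (set_type G)))
  (F' : set (set (set_type H))).
Hypotheses (FB : coset_basis F) (FB' : coset_basis F').

(** Conjugating translation by [x] with [f] gives a permutation of cosets in [H] that is a
    translation on every finite list; [closed_image] makes it a single translation, by [phi x]. For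
    continuity, [phi x] lies in [U] as soon as [x] fixes the coset [g U]. *)
Lemma coset_iso_hom f g : coset_iso F F' f g ->
  exists2 phi : set_type G -> set_type H, continuous phi &
    forall x A, cosets F A -> f (lcos x A) = lcos (phi x) (f A).
Proof.
case=> fD gD fl gl.
have phi_ex x : exists y, forall A, cosets F A -> f (lcos x A) = lcos y (f A).
  have [||||y yP] := @closed_image H (set (set_type H)) (@lcos (set_type H)) (cosets F')
     (fun B => f (lcos x (g B))) (@lcosM _) (@lcos1 _).
  - exact: lcos_cont.
  - exact: lcos_fin.
  - move=> B /gD[Dg fg].
    have [? gf] := fD _ (cosets_lcos x^-1 Dg).
    exists (f (lcos x^-1 (g B))) => //.
    by rewrite gf -lcosM mulgV lcos1.
  - move=> l lD; have [|y yP] := fl (map g l) x.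
      by move=> _ /mapP[B /lD/gD[? _] ->].
    by exists y => B Bl; rewrite yP ?map_f// (gD _ (lD _ Bl)).2.
  exists y => A /fD[DfA gf]; by rewrite yP// gf.
have [phi phiP] := ex_choice phi_ex.
exists phi => //; apply: continuous_morph.
  move=> x y; apply: (cosets_faithful FB') => U FU.
  have [DU fgU] := gD _ (fam_cosets FU).
  rewrite -fgU -phiP// !lcosM -!phiP//; exact: cosets_lcos.
move=> t; have [l lF lt] := cb_basic FB' t.
have [|s sP] := @fixes_collect G _ l (fun x U => U (phi x)).
  move=> U Ul; have [DU fgU] := gD _ (fam_cosets (lF _ Ul)).
  have [s sP] := lcos_cont FB DU; exists s => x /sP E.
  have [U1 _ _] := cb_sub FB' (lF _ Ul).
  have : lcos (phi x) U (phi x) by rewrite /lcos/= mulVg.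
  by rewrite -{1}fgU -phiP// E fgU.
by exists s => x /sP; exact: lt.
Qed.

End CosetIso.

Lemma coset_iso_top (G H : closed_subgroup) (F : set (set (set_type G)))
    (F' : set (set (set_type H))) f g :
  coset_basis F -> coset_basis F' -> coset_iso F F' f g ->
  exists2 phi : set_type G -> set_type H, topological_isomorphism phi &
    forall x A, cosets F A -> f (lcos x A) = lcos (phi x) (f A).
Proof.
move=> FB FB' fgP; have [phi phi_c phiP] := coset_iso_hom FB FB' fgP.
have [psi psi_c psiP] := coset_iso_hom FB' FB (coset_iso_sym fgP).
case: fgP => fD gD _ _; exists phi => //; split=> //.
  move=> x y; apply: (cosets_faithful FB') => U FU.
  have [DU fgU] := gD _ (fam_cosets FU).
  rewrite -fgU -phiP// !lcosM -!phiP//; exact: cosets_lcos.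
exists psi => //; split=> x.
  apply: (cosets_faithful FB) => U FU; have [DU gfU] := fD _ (fam_cosets FU).
  rewrite -{1}gfU -psiP// -phiP; last exact: fam_cosets.
  by case: (fD _ (cosets_lcos x (fam_cosets FU))).
apply: (cosets_faithful FB') => U FU; have [DU gfU] := gD _ (fam_cosets FU).
rewrite -{1}gfU -phiP// -psiP; last exact: fam_cosets.
by case: (gD _ (cosets_lcos x (fam_cosets FU))).
Qed.

Lemma iso_coset_iso (G H : closed_subgroup) (F : set (set (set_type G)))
    (F' : set (set (set_type H))) (phi : set_type G -> set_type H)
    (psi : set_type H -> set_type G) :
  {morph phi : x y / x * y} -> cancel phi psi -> cancel psi phi ->
  (forall W, F W -> F' (phi @` W)) -> (forall W, F' W -> F (psi @` W)) ->
  coset_iso F F' (fun A => phi @` A) (fun B => psi @` B).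
Proof.
move=> phiM phiK psiK FF' F'F; have psiM := can_morph phiM phiK psiK.
split.
- move=> _ [W [x [FW ->]]]; rewrite image_imageK//; split=> //.
  by exists (phi @` W), (phi x); split; [exact: FF'|exact: image_lcos].
- move=> _ [W [x [FW ->]]]; rewrite image_imageK//; split=> //.
  by exists (psi @` W), (psi x); split; [exact: F'F|exact: image_lcos].
- by move=> l x _; exists (phi x) => A _; exact: image_lcos.
- by move=> l x _; exists (psi x) => A _; exact: image_lcos.
Qed.

(** * Automorphisms as permutations of cosets *)

Section Automorphisms.
Variables (G : closed_subgroup) (F : set (set (set_type G))).
Hypotheses (FB : coset_basis F).
Hypothesis F_Aut : forall (a : Aut (set_type G)) W, F W -> F (a @` W).
Local Notation D := (cosets F).
Local Notation T := (set_type G).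
Implicit Types a b : Aut T.

Lemma AutM a : {morph a : x y / x * y}.
Proof. by case: (aut_iso a). Qed.

Lemma AutVK a : cancel (a^-1)%g a.
Proof. exact: aut_invVK. Qed.

Lemma image_AutM a b A : (a * b)%g @` A = a @` (b @` A).
Proof. by rewrite image_comp. Qed.

Lemma image_Aut1 A : (1 : Aut T) @` A = A.
Proof. exact: image_id. Qed.

Lemma image_AutK a A : (a^-1)%g @` (a @` A) = A.
Proof. by rewrite -image_AutM mulVg image_Aut1. Qed.

Lemma image_AutVK a A : a @` ((a^-1)%g @` A) = A.
Proof. by rewrite -image_AutM mulgV image_Aut1. Qed.

Lemma image_Aut_inj a A B : a @` A = a @` B -> A = B.
Proof. by move=> AB; rewrite -(image_AutK a A) AB image_AutK. Qed.

Lemma cosets_Aut a A : D A -> D (a @` A).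
Proof.
case=> W [x [FW ->]]; exists (a @` W), (a x).
by split; [exact: F_Aut|exact: (image_lcos (@AutM a))].
Qed.

Lemma Aut_eq a b : (forall A, D A -> a @` A = b @` A) -> a = b.
Proof.
move=> ab; apply: Aut_ext => x; apply: (cosets_faithful FB) => U FU.
have FaU : F ((a^-1)%g @` U) by exact: F_Aut.
have [H1 H2] := (image_lcos (@AutM a) x ((a^-1)%g @` U), image_lcos (@AutM b) x ((a^-1)%g @` U)).
rewrite -[in LHS](image_AutVK a U) -H1 ab; last exact/cosets_lcos/fam_cosets.
by rewrite H2 -ab ?image_AutVK//; exact: fam_cosets.
Qed.

(** Agreement with automorphisms on finite lists makes [f] a coset isomorphism of [G] with itself,
    so [coset_iso_top] supplies [phi]. It remains to see that [f] takes images under [phi]. *)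
Lemma local_Aut (f : set T -> set T) :
  (forall B, D B -> exists2 A, D A & f A = B) ->
  (forall l : seq (set T), (forall A, A \in l -> D A) ->
     exists a : Aut T, forall A, A \in l -> f A = a @` A) ->
  exists a : Aut T, forall A, D A -> f A = a @` A.
Proof.
move=> fsurj floc.
have floc1 A : D A -> exists a : Aut T, f A = a @` A.
  move=> DA; have [|a aA] := floc [:: A]; first by move=> B; rewrite inE => /eqP ->.
  by exists a; apply: aA; rewrite inE.
have finj A B : D A -> D B -> f A = f B -> A = B.
  move=> DA DB; have [|a aP] := floc [:: A; B].
    by move=> C; rewrite !inE => /orP[/eqP ->|/eqP ->].
  by rewrite !aP ?inE ?eqxx ?orbT//; exact: image_Aut_inj.
have gex B : exists A, D B -> D A /\ f A = B.
  by have [/fsurj[A DA AB]|?] := pselect (D B); [exists A|exists B].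
have [g gP] := ex_choice gex.
have ci : coset_iso F F f g.
  split.
  - move=> A DA; have [a aA] := floc1 A DA.
    have DfA : D (f A) by rewrite aA; exact: cosets_Aut.
    by split=> //; have [Dg fg] := gP _ DfA; exact: finj.
  - by move=> B /gP.
  - move=> l x lD; have [|a aP] := floc (l ++ map (lcos x) l).
      by move=> A; rewrite mem_cat => /orP[/lD//|/mapP[B /lD DB ->]]; exact: cosets_lcos.
    exists (a x) => A Al; rewrite !aP ?mem_cat ?map_f ?Al ?orbT//.
    exact: (image_lcos (@AutM a)).
  - move=> l y lD; have [|a aP] := floc (map g l ++ map (g \o lcos y) l).
      move=> A; rewrite mem_cat => /orP[/mapP[B /lD/gP[? _] ->]//|/mapP[B /lD DB ->]].
      by have [] := gP _ (cosets_lcos y DB).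
    exists (a^-1 y) => B Bl; apply: (@image_Aut_inj a).
    have DB := lD _ Bl; rewrite (image_lcos (@AutM a)) AutVK.
    have <- : f (g B) = a @` g B by apply: aP; rewrite mem_cat map_f.
    have <- : f (g (lcos y B)) = a @` g (lcos y B).
      by apply: aP; rewrite mem_cat; apply/orP; right; apply/mapP; exists B.
    by rewrite (gP _ DB).2 (gP _ (cosets_lcos y DB)).2.
have [phi phi_iso phiP] := coset_iso_top FB FB ci.
exists (MkAut phi_iso) => _ [U [x [FU ->]]] /=.
have DU := fam_cosets FU.
have sU := cb_sub FB FU.
have sfU : is_subgroup (f U).
  by have [a ->] := floc1 U DU; exact: (is_subgroup_image (@AutM a)).
have [_ _ [psi _ [phiK psiK]]] := phi_iso.
(* [f (x U) = phi x (f U)] with [f U] a subgroup, so a point [z] of it gives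
   [f (x U) = f (psi z U)]; injectivity of [f] puts [psi z] in [x U]. *)
apply/seteqP; split=> z.
  move=> fz; exists (psi z) => //.
  have -> : lcos x U = lcos (psi z) U.
    apply: finj; [exact: cosets_lcos|exact: cosets_lcos|].
    by rewrite !phiP// psiK; apply: lcos_mem => //; rewrite -phiP.
  by rewrite /lcos/= mulVg; case: sU.
case=> y /(lcos_mem sU) -> <-; rewrite phiP// /lcos/= mulVg.
by case: sfU.
Qed.

Hypothesis G_olig : oligomorphic G.

(* An open subgroup containing a finite intersection [K] of subgroups in [F] is
   a union of finitely many double cosets of [K]. *)
Lemma open_coset_stabilizer B : open_subgroup_coset B ->
  exists2 l : seq (set T), forall A, A \in l -> D A &
    forall a, (forall A, A \in l -> a @` A = A) -> a @` B = B.
Proof.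
case=> W [sW oW] [x ->]; have [W1 WM WV] := sW.
have [s sP] := (open_gact W).1 oW 1 W1.
have [l0 l0F l0s] := cb_basic FB s.
pose K := [set y : T | forall U, U \in l0 -> U y].
have KW y : K y -> W y by move=> /l0s/sP; rewrite mul1g.
have [|t tK] := @fixes_collect G _ l0 (fun y U => U y).
  by move=> U /l0F; exact: (cb_open FB).
have [r rW rP] := finite_double_cosets G_olig t W.
(* An automorphism preserving all of [l] preserves [K] and moves each listed [y] inside [y K], hence
   keeps the products [h * y * k] that make up [W] inside [W]. *)
pose l := l0 ++ [seq lcos y U | y <- x :: r, U <- l0].
have lD A : A \in l -> D A.
  rewrite mem_cat => /orP[/l0F/fam_cosets//|/allpairsP[[y U] /= [_ Ul ->]]].
  exact/cosets_lcos/fam_cosets/l0F.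
exists l => // a0 a0l; rewrite -lcosE.
have sub a : (forall A, A \in l -> a @` A = A) -> a @` lcos x W `<=` lcos x W.
  move=> al.
  have aK y : K y -> K (a y).
    move=> Ky U Ul; rewrite -(al U); last by rewrite mem_cat Ul.
    by exists y => //; exact: Ky.
  have aKr y : y \in x :: r -> K (y^-1 * a y).
    move=> yr U Ul; have : lcos y U (a y) => //.
    rewrite -(al (lcos y U)); last by rewrite mem_cat allpairs_f ?orbT.
    by exists y => //; rewrite /lcos/= mulVg; case: (cb_sub FB (l0F _ Ul)).
  have aW w : W w -> W (a w).
    move=> /rP[y yr [h [k [/tK/aK/KW Wh /tK/aK/KW Wk ->]]]].
    rewrite !AutM; apply: (WM) => //; apply: (WM) => //.
    have -> : a y = y * (y^-1 * a y) by rewrite mulgA mulgV mul1g.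
    apply: WM; first exact: rW.
    by apply: KW (aKr y _); rewrite in_cons yr orbT.
  move=> _ [z Wz <-]; rewrite /lcos/=.
  have -> : x^-1 * a z = (x^-1 * a x) * a (x^-1 * z).
    by rewrite -mulgA -AutM mulgA mulgV mul1g.
  by apply: WM; [by apply: KW (aKr x _); rewrite in_cons eqxx|exact: aW].
apply/seteqP; split; first exact: sub.
move=> z Wz; exists (a0^-1 z); last exact: AutVK.
apply: (sub (a0^-1)%g); last by exists z.
by move=> A Al; rewrite -[in LHS](a0l A Al) image_AutK.
Qed.

End Automorphisms.

(** * Finite codes and countability of cosets *)

Section Codes.
Variable G : closed_subgroup.
Local Notation T := (set_type G).

(* A code [(s, bs)] denotes the set of the elements [x] of [G] such that [x s] is
   conjugate to an element of [bs] under the pointwise stabiliser of [s]. *)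
Definition code : Type := seq nat * seq (seq nat).

Definition coded (c : code) : set T := [set x |
  exists2 b, b \in c.2 & orb G (c.1 ++ map (gact x) c.1) (c.1 ++ b)].

(** [A] is a finite union of double cosets of the stabiliser of [s], each determined by the values
    on [s] of a representative. *)
Lemma coded_exists (s : seq nat) (A : set T) : oligomorphic G ->
  (forall x h k, A x -> fixes h s -> fixes k s -> A (h * x * k)) ->
  exists c : code, A = coded c.
Proof.
move=> olig HA; have [r rA rP] := finite_double_cosets olig s A.
exists (s, [seq map (gact x) s | x <- r]); apply/seteqP; split=> x.
  case/rP => y yr [h [k [/fixesP hs ks ->]]]; exists (map (gact y) s).
    by rewrite /=; apply/mapP; exists y.
  by apply: orb_sym; exists h; rewrite map_cat hs map_gact_fixes// map_gactM.
case=> _ /= /mapP[y yr ->] [h]; rewrite map_cat => /eqP.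
rewrite eqseq_cat ?size_map// => /andP[/eqP/fixesP hs /eqP hy].
have -> : x = h^-1 * y * (y^-1 * (h * x)) by rewrite !mulgA mulgK mulVg mul1g.
apply: HA; [exact: rA|exact: fixesV|].
by apply: fixes_map; rewrite map_gactM hy.
Qed.

Lemma codedM c x h k : coded c x -> fixes h c.1 -> fixes k c.1 ->
  coded c (h * x * k).
Proof.
case=> b bc xb hs ks; exists b => //; apply: orb_trans xb; apply: orb_sym.
by exists h; rewrite map_cat (fixesP _ _).1// map_gact_fixes// map_gactM.
Qed.

End Codes.

Arguments coded G c : clear implicits.

Section CountableCosets.
Variables (G : closed_subgroup) (F : set (set (set_type G))).
Hypotheses (FB : coset_basis F) (G_olig : oligomorphic G).
Local Notation T := (set_type G).
Local Notation D := (cosets F).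

Lemma cosets_coded A : D A -> exists c, A = coded G c.
Proof.
move=> DA; have [s sA] := lcos_cont FB DA.
case: DA sA => W [y [FW ->]] sA; have [t tW] := cb_open FB FW.
apply: (@coded_exists _ (s ++ t)) => // x h k Ax /fixes_cat[hs _] /fixes_cat[_ kt].
have sW := cb_sub FB FW.
have : lcos y W (h * x) by rewrite -(sA h)// /lcos/= mulKg.
rewrite /lcos/= !mulgA => Whx; apply/(subgroupMr _ sW) => //; exact: tW.
Qed.

Lemma cosets_enum : exists e : nat -> set T, forall A, D A -> exists n, e n = A.
Proof.
exists (fun n => if unpickle n is Some c then coded G c else set0).
by move=> A /cosets_coded[c ->]; exists (pickle c); rewrite pickleK.
Qed.

(** With finitely many cosets, an element of [G] would be determined by those containing it, so [G]
    would be finite; but a finite group has infinitely many orbits on [nat]. Infinitude lets the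
    cosets be indexed bijectively by [nat]. *)
Lemma cosets_infinite : infinite_set D.
Proof.
move=> /finite_seqP[d dP].
have Dd A : D A -> A \in d by move=> DA; have : [set` d] A by rewrite -dP.
have [L LP] := finite_seqs [:: true; false] (size d).
have [|r _ rP] := @finite_reps _ _ setT
  (fun x c => c = [seq `[< A x >] | A : set T <- d]) L.
  move=> x _; exists [seq `[< A x >] | A : set T <- d] => //.
  by apply: LP; rewrite ?size_map// => -[].
have rT x : x \in r.
  have [y yr [c -> /eq_in_map xy]] := rP x I.
  suff -> : x = y by [].
  apply: (cosets_faithful FB) => U FU; have sU := cb_sub FB FU.
  have DxU := cosets_lcos x (fam_cosets FU).
  apply: lcos_mem => //; apply/asboolP; rewrite -(xy _ (Dd _ DxU)).
  by apply/asboolP; rewrite /lcos/= mulVg; case: sU.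
have [L1 L1P] := oligomorphic_orb G_olig 1.
apply: infinite_nat; apply/finite_seqP.
exists (flatten [seq map (gact x) t | x <- r, t <- L1]).
apply/seteqP; split=> // u _ /=; have [t tL [x xt]] := L1P [:: u] erefl.
apply/flattenP; exists (map (gact x) t); first exact: allpairs_f.
by rewrite xt inE.
Qed.

Lemma cosets_bij : exists (e : nat -> set T) (e' : set T -> nat),
  [/\ forall n, D (e n), cancel e e' & forall A, D A -> e (e' A) = A].
Proof.
have cD : countable D.
  have [e eP] := cosets_enum.
  have : countable (range e).
    by exact: sub_countable (card_image_le e setT) (countableP _).
  apply: sub_countable; apply: subset_card_le => A /eP[n <-]; by exists n.
have DN : ([set: nat] #= D)%card.
  by rewrite card_eq_le; apply/andP; split=> //; apply/infiniteP/cosets_infinite.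
have [e [eD einj esurj]] := card_set_bijP DN.
have H A : exists n, D A -> e n = A.
  by have [/esurj[n _ <-]|] := pselect (D A); [exists n|exists 0%N].
have [e' e'P] := ex_choice H.
exists e, e'; split=> // n; first exact: eD.
by apply: einj; rewrite ?inE//; apply/e'P/eD.
Qed.

End CountableCosets.

(** * Inner automorphisms and the topology of the automorphism group *)

Section InnerAutomorphisms.
Variable G : closed_subgroup.
Local Notation T := (set_type G).

Lemma inn_iso (x : T) : topological_isomorphism (fun y : T => x * y * x^-1).
Proof.
have conj_cont (z : T) : continuous (fun y : T => z * y * z^-1).
  apply: continuous_morph => [y y'|t]; first by rewrite !mulgA mulgVK.
  exists (map (gact z^-1) t) => y /fixes_conj; by rewrite invgK.
split; [by move=> y y'; rewrite !mulgA mulgVK|exact: conj_cont|].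
exists (fun y => x^-1 * y * x^-1^-1); first exact: conj_cont.
split=> y; rewrite !invgK !mulgA.
  by rewrite mulVg mul1g mulgVK.
by rewrite mulgV mul1g mulgK.
Qed.

Definition inn (x : T) : Aut T := MkAut (inn_iso x).

Lemma image_inn x A : inn x @` A = cjs x A.
Proof.
rewrite cjsE; apply: eq_imagel => y _.
by rewrite /conjg invgK mulgA.
Qed.

Lemma Inn_inn x : Inn_set (inn x).
Proof. by exists x. Qed.

Lemma InnP a : Inn_set a <-> exists x, a = inn x.
Proof.
split=> [[x ax]|[x ->]]; last exact: Inn_inn.
by exists x; apply: Aut_ext.
Qed.

End InnerAutomorphisms.

Section AutTopology.
Variables (G : closed_subgroup) (F : set (set (set_type G))).
Hypotheses (FB : coset_basis F) (G_olig : oligomorphic G).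
Local Notation T := (set_type G).
Local Notation D := (cosets F).

Lemma cosets_open A : D A -> open_subgroup_coset A.
Proof.
case=> W [x [FW ->]]; exists W; last by exists x; exact: lcosE.
have sW := cb_sub FB FW; split=> //; apply/open_gact => y Wy.
have [s sP] := cb_open FB FW; exists s => z /sP Wz.
by apply/subgroupMl.
Qed.

(** By [open_coset_stabilizer] the stabiliser of any open coset contains that of finitely many
    members of [D]; the topology is thus that of pointwise convergence on [D]. *)
Lemma nbhs_Aut (a : Aut T) (N : set (Aut T)) : nbhs a N <->
  exists2 l : seq (set T), forall A, A \in l -> D A &
    forall b : Aut T, (forall A, A \in l -> b @` A = a @` A) -> N b.
Proof.
split.
  case=> _ [E [/finite_seqP[m ->] mo ->]] mN.
  have [l lD lP] : exists2 l : seq (set T), forall A, A \in l -> D A &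
      forall c : Aut T, (forall A, A \in l -> c @` A = A) ->
      forall B, B \in m -> c @` B = B.
    elim: m mo {mN} => [|B m IH] mo; first by exists [::].
    have [|l lD lP] := IH; first by move=> C Cm; apply: mo; rewrite /= inE Cm orbT.
    have [|k kD kP] := open_coset_stabilizer FB G_olig (mo B _).
      by rewrite /= inE eqxx.
    exists (l ++ k) => [A|c cP C]; first by rewrite mem_cat => /orP[/lD|/kD].
    rewrite inE => /orP[/eqP ->|Cm].
      by apply: kP => A Ak; apply: cP; rewrite mem_cat Ak orbT.
    by apply: lP => // A Al; apply: cP; rewrite mem_cat Al.
  exists l => // b bl; have -> : b = a * (a^-1 * b) by rewrite mulgA mulgV mul1g.
  apply: mN => B Bm; apply: lP => // A Al.
  by rewrite image_AutM bl// image_AutK.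
case=> l lD lN; exists (setwise_stabilizer [set` l]).
  by exists [set` l]; split=> //= A /lD/cosets_open.
by move=> c cl; apply: lN => A Al; rewrite image_AutM cl.
Qed.

End AutTopology.

(** * The automorphism group *)

Section QuasiOligomorphic.
Variables (G : closed_subgroup) (F : set (set (set_type G))).
Hypotheses (FB : coset_basis F) (G_olig : oligomorphic G).
Hypothesis F_Aut : forall (a : Aut (set_type G)) W, F W -> F (a @` W).
Local Notation T := (set_type G).
Local Notation D := (cosets F).

Lemma Aut_quasi_oligomorphic : quasi_oligomorphic (Aut T).
Proof.
have [e [e' [eD eK e'K]]] := cosets_bij FB G_olig.
have aD (a : Aut T) n : D (a @` e n) by exact: cosets_Aut.
have sig_bij (a : Aut T) : bijective (fun n => e' (a @` e n)).
  exists (fun n => e' ((a^-1)%g @` e n)) => n.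
    by rewrite e'K// image_AutK eK.
  by rewrite e'K// image_AutVK eK.
pose sig (a : Aut T) : Sym := MkSym (sig_bij a).
have esig (a : Aut T) n : e (sig a n) = a @` e n by rewrite /= e'K.
have e_inj : injective e := can_inj eK.
have sigM a b : sig (a * b) = sig a * sig b.
  apply: Sym_ext => n; apply: e_inj.
  by rewrite -[(sig a * sig b) n]/(sig a (sig b n)) !esig image_AutM.
have sig1 : sig 1 = 1.
  by apply: Sym_ext => n; apply: e_inj; rewrite esig image_Aut1.
have sigV a : sig a^-1 = (sig a)^-1.
  by apply: (@mulgI _ (sig a)); rewrite -sigM !mulgV sig1.
have sig_inj : injective sig.
  move=> a b ab; apply: (Aut_eq FB F_Aut) => A DA.
  by rewrite -(e'K A)// -!esig ab.
have rsub : is_subgroup (range sig).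
  split; first by exists 1.
    by move=> _ _ [a _ <-] [b _ <-]; exists (a * b).
  by move=> _ [a _ <-]; exists a^-1.
have rclosed : closed (range sig).
  move=> f clf.
  have floc (s : seq nat) : exists a, forall i, i \in s -> sig a i = f i.
    have [|_ [[a _ <-] af]] := clf [set h : Sym | forall i, i \in s -> h i = f i].
      by apply/nbhs_Sym; exists s.
    by exists a.
  have [||a aP] := @local_Aut G F FB F_Aut (fun A => e (f (e' A))).
  - move=> B DB; exists (e ((f^-1 : Sym) (e' B))) => //.
    by rewrite eK -[f _]/((f * f^-1) (e' B)) mulgV e'K.
  - move=> l lD; have [a aP] := floc (map e' l).
    exists a => A Al; rewrite -aP ?map_f// esig e'K//; exact: lD.
  exists a => //; apply: Sym_ext => n; apply: e_inj.
  by rewrite esig -aP// eK.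
pose H := @ClosedSubgroup (ClosedSubset rclosed) rsub.
have HinP a : sig a \in (H : set Sym) by apply/mem_set; exists a.
exists H.
  move=> n; have [r rD rP] := finite_conjugation_orbits FB G_olig n.
  have [|r' _ r'P] := @finite_reps (n.-tuple nat) _ setT
    (fun t Bs => exists x, map e t = map (cjs x) Bs) r.
    move=> t _; have [||Bs Br BsP] := rP (map e t); last by exists Bs.
      by rewrite size_map size_tuple.
    by move=> _ /mapP[i _ ->].
  apply: (@sub_finite_set _ _ [set tuple_orbit H t | t in [set` r']]); last first.
    by apply: finite_image; apply/finite_seqP; exists r'.
  move=> _ [t _ <-]; have [u ur [Bs [x tx] [y uy]]] := r'P t I.
  exists u => //.
  (* Both tuples are conjugate to [Bs], by [x] and by [y], so conjugation by [x * y^-1] takes [u] to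
     [t] and the orbits coincide. *)
  have tu : t = map_tuple (sig (inn (x * y^-1))) u.
    apply: val_inj; apply: (inj_map e_inj); rewrite /= -map_comp.
    rewrite [RHS](eq_map (g := cjs (x * y^-1) \o e)); last first.
      by move=> i; rewrite -[LHS]/(e (sig (inn (x * y^-1)) i)) esig image_inn.
    rewrite map_comp uy tx -map_comp; apply: eq_map => B /=.
    by rewrite -cjsM mulgVK.
  apply/seteqP; split=> _ [h Hh <-].
    exists (h * (sig (inn (x * y^-1)))^-1).
      have [_ rM rV] := rsub; apply: rM => //; apply: rV; by exists (inn (x * y^-1)).
    rewrite tu; apply: val_inj; rewrite /= -map_comp; apply: eq_map => i /=.
    rewrite -[LHS]/((h * (sig (inn (x * y^-1)))^-1 * sig (inn (x * y^-1))) i).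
    by rewrite mulgVK.
  exists (h * sig (inn (x * y^-1))).
    by have [_ rM _] := rsub; apply: rM => //; exists (inn (x * y^-1)).
  by rewrite tu; apply: val_inj; rewrite /= -map_comp.
pose Phi (a : Aut T) : set_type H := SigSub (HinP a).
have Phi_surj y : exists a, Phi a = y.
  have [a _ ay] := set_mem (valP y); by exists a; apply: val_inj.
have [Psi PsiK] := ex_choice Phi_surj.
have PhiK a : Psi (Phi a) = a.
  by apply: sig_inj; rewrite -[LHS]/(val (Phi (Psi (Phi a)))) PsiK.
exists Phi; split.
- by move=> a b; apply: val_inj; exact: sigM.
- move=> a N /nbhs_gact[s sN]; apply/(nbhs_Aut FB G_olig).
  exists (map e s) => [_ /mapP[i _ ->]//|b bs]; apply: sN => i si.
  by apply: e_inj; rewrite /gact/= -/(sig b i) -/(sig a i) !esig bs// map_f.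
- exists Psi => //; move=> y N /(nbhs_Aut FB G_olig)[l lD lN].
  apply/nbhs_gact; exists (map e' l) => z zy; apply: lN => A Al.
  have DA := lD _ Al.
  rewrite -[in LHS](e'K A)// -[in RHS](e'K A)// -!esig; congr e.
  have -> : sig (Psi z) = val z by rewrite -[in RHS](PsiK z).
  have -> : sig (Psi y) = val y by rewrite -[in RHS](PsiK y).
  exact/zy/map_f.
Qed.

End QuasiOligomorphic.

(** * The outer automorphism group *)

Section OuterAutomorphisms.
Variables (G : closed_subgroup) (F : set (set (set_type G))).
Hypotheses (FB : coset_basis F) (G_olig : oligomorphic G).
Hypothesis F_Aut : forall (a : Aut (set_type G)) W, F W -> F (a @` W).
Local Notation T := (set_type G).
Local Notation D := (cosets F).

(* An element normalising [K] permutes the finitely many fixed points of [K]. *)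
Lemma cjs_fin (u : nat) : exists2 l : seq (set T),
  forall d, d \in l -> D d &
  finite_set [set gact x u | x in
    [set x : T | forall d, d \in l -> cjs x d = d]].
Proof.
have [l lF lu] := cb_basic FB [:: u].
exists l; first by move=> d /lF /fam_cosets.
have [|t tK] := @fixes_collect G _ l (fun y U => U y).
  by move=> U /lF; exact: (cb_open FB).
have [L LP] := finite_fixed_points G_olig t.
apply: (@sub_finite_set _ _ [set` L]); last by apply/finite_seqP; exists L.
move=> _ [x /= xl <-]; apply: LP => k /tK kl.
have : fixes (x^-1 * k * x) [:: u].
  apply: lu => U Ul; have : cjs x U k by rewrite xl//; exact: kl.
  by [].
move=> /(_ u (mem_head _ _)); rewrite !gactM => E.
by rewrite -[in RHS]E gactVK.
Qed.

(** The closedness of the inner automorphisms: [closed_image] for conjugation, with [cjs_fin] as its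
    finiteness condition. *)
Lemma local_Inn (a : Aut T) :
  (forall l : seq (set T), (forall A, A \in l -> D A) ->
    exists x, forall A, A \in l -> cjs x A = a @` A) ->
  exists x, a = inn x.
Proof.
move=> aloc; have [|x xP] := @closed_image G (set T) (@cjs T) D (fun A => a @` A)
    (@cjsM _) (@cjs1 _) (cjs_cont FB) cjs_fin _ aloc.
  move=> A DA; exists ((a^-1)%g @` A); [exact: cosets_Aut|exact: image_AutVK].
by exists x; apply: (Aut_eq FB F_Aut) => A /xP <-; rewrite image_inn.
Qed.

Let q (a : Aut T) : Out T := (\pi_(quotient_group (Inn T)) a)%qT.

Let q_surj z : exists a, q a = z.
Proof. by exists (repr z); exact: pi_repr. Qed.

(** Normality lets the inner factor stand on the left, where it acts on images by [cjs]. *)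
Let qP a b : q a = q b <-> exists x, b = inn x * a.
Proof.
split=> [qab|[x ->]].
  have Iab : Inn_set (a^-1 * b) by exact: (proj1 (Defs.piP (Inn T) a b) qab).
  have : Inn_set ((a^-1 * b) ^ a^-1) by exact: Inn_normal.
  move=> /InnP[x xE]; exists x.
  by rewrite -xE /conjg invgK !mulgA mulgV mul1g mulgVK.
apply: (proj2 (Defs.piP (Inn T) a (inn x * a))); rewrite mulgA.
have -> : a^-1 * inn x * a = inn x ^ a by rewrite /conjg mulgA.
by apply: Inn_normal; exact: Inn_inn.
Qed.

Let qMinn a x : q (a * inn x) = q a.
Proof.
apply/esym/(proj2 (Defs.piP (Inn T) a (a * inn x))); rewrite mulgA mulVg mul1g; exact: Inn_inn.
Qed.

Let open_Aut (N : set (Aut T)) :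
  (forall a, N a -> exists2 l : seq (set T), forall A, A \in l -> D A &
    forall b : Aut T, (forall A, A \in l -> b @` A = a @` A) -> N b) -> open N.
Proof. by move=> HN; rewrite openE => a /HN/(nbhs_Aut FB G_olig). Qed.

(** If [b * a^-1] is not inner, [local_Inn] gives a finite list on which no conjugate of [a] agrees
    with [b]. The set of classes with a representative agreeing with [a] on that list is clopen,
    since it and its complement depend only on values on the list. *)
Lemma Out_zero_dimensional : zero_dimensional (Out T).
Proof.
move=> z w zw; have [a az] := q_surj z; have [b bw] := q_surj w.
have [l lD lP] : exists2 l : seq (set T), forall A, A \in l -> D A &
    forall x, ~ forall A, A \in l -> b @` A = cjs x (a @` A).
  apply: contrapT => N; move/eqP: zw; apply; rewrite -az -bw; apply/qP.
  have [|x bax] := @local_Inn (b * a^-1); last by exists x; rewrite -bax mulgVK.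
  move=> l lD; apply: contrapT => Nl; apply: N.
  exists (map (fun A => (a^-1)%g @` A) l).
    by move=> _ /mapP[A /lD DA ->]; exact: cosets_Aut.
  move=> x H; apply: Nl; exists x => A Al.
  by rewrite image_AutM H ?image_AutVK//; apply/mapP; exists A.
pose U : set (Out T) := [set q c | c in
  [set c : Aut T | forall A, A \in l -> c @` A = a @` A]].
have UP c : U (q c) <-> exists x, forall A, A \in l -> c @` A = cjs x (a @` A).
  split=> [[d /= dl /qP[x ->]]|[x xP]].
    by exists x => A Al; rewrite image_AutM image_inn dl.
  exists (inn x^-1 * c); last by apply/esym/qP; exists x^-1.
  by move=> A Al; rewrite image_AutM image_inn xP// cjsK.
exists U; split.
- split.
    apply: pi_open; apply: open_Aut => c cl; exists l => // d dl A Al.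
    by rewrite dl// cl.
  rewrite -[U]setCK; apply: open_closedC.
  have -> : ~` U = q @` [set c | ~ U (q c)].
    apply/seteqP; split=> [v|_ [c Uc <-]//].
    by have [c <-] := q_surj v; exists c.
  apply: pi_open; apply: open_Aut => c Uc; exists l => // d dl /UP[x xP].
  by apply: Uc; apply/UP; exists x => A Al; rewrite -dl// xP.
- by rewrite -az; apply/UP; exists 1 => A _; rewrite cjs1.
- by rewrite -bw => /UP[x /lP].
Qed.

Lemma ultra_bigcup (X : Type) (I : eqType) (U : set_system X) (r : seq I)
    (S : I -> set X) (A : set X) : UltraFilter U -> U A ->
  (forall z, A z -> exists2 i, i \in r & S i z) -> exists2 i, i \in r & U (S i).
Proof.
move=> UU UA; elim: r A UA => [|i r IH] A UA AS.
  by have [z /AS[]] := filter_ex UA.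
have [USi|USi] := in_ultra_setVsetC (S i) UU; first by exists i; rewrite ?inE ?eqxx.
have [||j jr USj] := IH (A `&` ~` S i); first exact: filterI.
  move=> z [/AS[j jr Sj] NSi]; move: jr; rewrite inE => /orP[/eqP ji|jr]; last by exists j.
  by rewrite ji in Sj.
by exists j => //; rewrite inE jr orbT.
Qed.

(* For an ultrafilter [U] on [Out G], the pairs of tuples that are matched by
   some representative of [U]-almost every class form a back-and-forth system;
   the automorphism it produces represents the limit of [U]. *)
Lemma Out_compact : compact [set: Out T].
Proof.
rewrite compact_ultra => U UU _.
pose M (s : seq (set T * set T)) (a : Aut T) : Prop :=
  forall p, p \in s -> a @` p.1 = p.2.
pose R (s : seq (set T * set T)) : Prop :=
  (forall p, p \in s -> D p.1 /\ D p.2) /\ U [set q a | a in M s].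
have Mcons s A B a : M s a -> a @` A = B -> M ((A, B) :: s) a.
  by move=> Ms AB p; rewrite inE => /orP[/eqP ->|/Ms].
have Rcons s A B : R s -> D A -> D B -> U [set q a | a in M ((A, B) :: s)] ->
    R ((A, B) :: s).
  move=> [sD _] DA DB UM; split=> // p; by rewrite inE => /orP[/eqP ->|/sD].
have Rex s : R s -> exists a, M s a by move=> [_ /filter_ex[_ [a Ma _]]]; exists a.
have forth s A : R s -> D A -> exists2 B, D B & R ((A, B) :: s).
  move=> Rs DA; have [sD Us] := Rs.
  have [r _ rP] := finite_conjugation_orbits FB G_olig (size s).+1.
  (* The classes are divided by the orbit of the value at [A] together with the range of [s]; [U]
     contains one of the finitely many pieces. *)
  pose S Bs := [set z | exists a x, [/\ q a = z, M s a &
    a @` A :: map snd s = map (cjs x) Bs]].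
  have [|Bs _ US] := @ultra_bigcup _ _ U r S _ UU Us.
    move=> _ [a Ma <-]; have [||Bs Br [x xP]] := rP (a @` A :: map snd s).
    - by rewrite /= size_map.
    - move=> B; rewrite inE => /orP[/eqP ->|/mapP[p /sD[_ Dp] ->]//].
      exact: cosets_Aut.
    by exists Bs => //; exists a, x.
  have [_ [a0 [x0 [_ M0 E0]]]] := filter_ex US.
  (* Every other [a] in the piece is corrected by the inner automorphism taking its tuple to that of
     [a0]: it fixes the range of [s] and leaves the class unchanged. *)
  exists (a0 @` A); first exact: cosets_Aut.
  apply: Rcons => //; first exact: cosets_Aut.
  apply: filterS US => _ [a [x [<- Ma Ea]]].
  have E : map (cjs (x0 * x^-1)) (a @` A :: map snd s) = a0 @` A :: map snd s.
    rewrite Ea E0 -map_comp; apply: eq_map => B /=.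
    by rewrite -cjsM mulgVK.
  exists (inn (x0 * x^-1) * a); last by apply/esym/qP; exists (x0 * x^-1).
  case: E => EA Es; apply: Mcons; last by rewrite image_AutM image_inn.
  move=> p ps; rewrite image_AutM image_inn Ma//.
  have := Es; rewrite -map_comp => /eq_in_map; exact.
have back s B : R s -> D B -> exists2 A, D A & R ((A, B) :: s).
  move=> Rs DB; have [sD Us] := Rs.
  have [r _ rP] := finite_conjugation_orbits FB G_olig (size s).+1.
  pose S Bs := [set z | exists a x, [/\ q a = z, M s a &
    (a^-1)%g @` B :: map fst s = map (cjs x) Bs]].
  have [|Bs _ US] := @ultra_bigcup _ _ U r S _ UU Us.
    move=> _ [a Ma <-]; have [||Bs Br [x xP]] := rP ((a^-1)%g @` B :: map fst s).
    - by rewrite /= size_map.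
    - move=> A; rewrite inE => /orP[/eqP ->|/mapP[p /sD[Dp _] ->]//].
      exact: cosets_Aut.
    by exists Bs => //; exists a, x.
  have [_ [a0 [x0 [_ M0 E0]]]] := filter_ex US.
  (* Now the correction acts on the domain of [s], so it is composed on the right. *)
  exists ((a0^-1)%g @` B); first exact: cosets_Aut.
  apply: Rcons => //; first exact: cosets_Aut.
  apply: filterS US => _ [a [x [<- Ma Ea]]].
  have E : map (cjs (x * x0^-1)) ((a0^-1)%g @` B :: map fst s) = (a^-1)%g @` B :: map fst s.
    rewrite Ea E0 -map_comp; apply: eq_map => A /=.
    by rewrite -cjsM mulgVK.
  exists (a * inn (x * x0^-1)); last exact: qMinn.
  case: E => EB Es; apply: Mcons.
    move=> p ps; rewrite image_AutM image_inn -[RHS]Ma//; congr image.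
    have := Es; rewrite -map_comp => /eq_in_map; exact.
  by rewrite image_AutM image_inn EB image_AutVK.
have R_inj s p p' : R s -> p \in s -> p' \in s -> p.1 = p'.1 <-> p.2 = p'.2.
  move=> /Rex[a aP] ps p's; rewrite -(aP _ ps) -(aP _ p's).
  by split=> [->//|]; exact: image_Aut_inj.
have R0 : R [::].
  split=> //; apply: filterS filterT => z _; have [a <-] := q_surj z.
  by exists a.
have [e eP] := cosets_enum FB G_olig.
have [f [g [fP gP fR]]] := back_and_forth eP eP R0 forth back R_inj.
have [||a aP] := @local_Aut G F FB F_Aut f.
- by move=> B /gP[Dg fg]; exists (g B).
- move=> l /fR[s /Rex[a Ma] sP]; exists a => A /sP /Ma.
  by [].
(* A neighbourhood of [q a] contains the class of every automorphism agreeing with [a] on some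
   finite list; by [fR] these classes form a member of [U]. *)
exists (q a); split=> // N Nqa.
have : nbhs a (q @^-1` N) by exact: (@Defs.pi_cont _ (Inn T) a N Nqa).
move=> /(nbhs_Aut FB G_olig)[l lD lN]; have [s [_ Us] sP] := fR l lD.
apply: filterS Us => _ [b Mb <-]; apply: lN => A Al.
by rewrite -aP ?(Mb _ (sP _ Al))//; exact: lD.
Qed.

Lemma Out_profinite : profinite (Out T).
Proof.
split; first exact: Out_compact.
- move=> z w zw; apply: contrapT => /eqP/Out_zero_dimensional[U [[oU cU] Uz Uw]].
  have [||v [Uv]//] := zw U (~` U); first exact: open_nbhs_nbhs.
  by apply: open_nbhs_nbhs; split=> //; exact: closed_openC.
- exact: zero_dimension_totally_disconnected Out_zero_dimensional.
Qed.

End OuterAutomorphisms.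

(** * Subgroups picked by the relation *)

(** A limit of points of [W] is some [x] in [G]; it agrees on [s] with some [y] in [W], and
    [y^-1 * x] fixes [s], so lies in [W]. *)
Lemma open_subgroup_closed (G : closed_subgroup) (W : set (set_type G)) :
  is_subgroup W -> (exists s, forall x, fixes x s -> W x) ->
  exists U : closed_subgroup, (U : set Sym) = set_val @` W.
Proof.
move=> sW [s sP]; have [W1 WM WV] := sW.
have cW : closed (set_val @` W).
  move=> f clf.
  have floc (t : seq nat) : exists2 x, W x & forall i, i \in t -> gact x i = f i.
    have [|_ [[x Wx <-] xf]] := clf [set h : Sym | forall i, i \in t -> h i = f i].
      by apply/nbhs_Sym; exists t.
    by exists x.
  have [|x xf] := @closed_gact G f.
    by move=> t; have [x _ xt] := floc t; exists x.
  have [y Wy ys] := floc s; exists x => //.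
  have -> : x = y * (y^-1 * x) by rewrite mulgA mulgV mul1g.
  apply: WM => //; apply: sP => i si.
  by rewrite gactM [gact x i](_ : _ = gact y i) ?gactK// ys// /gact xf.
have sgW : is_subgroup (set_val @` W).
  split; first by exists 1.
    by move=> _ _ [x Wx <-] [y Wy <-]; exists (x * y); [exact: WM|].
  by move=> _ [x Wx <-]; exists x^-1; [exact: WV|].
by exists (@ClosedSubgroup (ClosedSubset cW) sgW).
Qed.

Section PickedFamily.
Variables (V : set closed_subgroup) (P : closed_subgroup -> closed_subgroup -> Prop).
Hypothesis P_open : forall U G, P U G -> V G /\ open_subgroup_of U G.
Hypothesis P_invariant : invariant_relation V P.
Hypothesis P_sub_basic : sub_basic V P.
Hypothesis P_finite : forall G, V G -> finitely_many_conjugacy_classes P G.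

Definition picked (G : closed_subgroup) : set (set (set_type G)) :=
  [set set_val @^-1` (U : set Sym) | U in [set U : closed_subgroup | P U G]].

Arguments picked G : clear implicits.

Lemma picked_sub G W : picked G W -> is_subgroup W.
Proof. by case=> U /P_open[_ [_ []]] + _ <-. Qed.

Lemma picked_open G W : picked G W -> exists s, forall x, fixes x s -> W x.
Proof.
case=> U /P_open[_ [_ []]] [U1 _ _] /open_gact oU <-.
by have [s sP] := oU 1 U1; exists s => x /sP; rewrite mul1g.
Qed.

(** Invariance of [P] speaks of closed subgroups of [Sym], so the image must first be seen to be
    one: it is open because [psi] is continuous. *)
Lemma picked_iso (G H : closed_subgroup) (phi : set_type G -> set_type H) W :
  V G -> V H -> topological_isomorphism phi -> picked G W ->
  picked H (phi @` W).
Proof.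
move=> VG VH phi_iso FW; have [phiM _ [psi psic [phiK psiK]]] := phi_iso.
have [U' U'E] : exists U' : closed_subgroup, (U' : set Sym) = set_val @` (phi @` W).
  apply: open_subgroup_closed.
    apply: is_subgroup_image => //; exact: picked_sub FW.
  rewrite (image_can phiK psiK).
  have psiM := can_morph phiM phiK psiK.
  have [s sP] := picked_open FW.
  have : nbhs (1 : set_type H) (psi @^-1` [set x | fixes x s]).
    apply: psic; rewrite (morph_1 psiM); apply/nbhs_gact; exists s => y Hy i si.
    by rewrite Hy.
  move=> /nbhs_gact[t tP]; exists t => y fy; apply/sP/tP => i ti.
  by rewrite fy.
case: FW U'E => U PU <- U'E; have [_ [UG _]] := P_open PU.
have PU' : P U' H.
  by apply/(P_invariant VG VH phi_iso UG (U' := U')) => //; rewrite U'E image_comp.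
exists U' => //; rewrite U'E; apply/seteqP; split=> y /=.
  by case=> z Wz /val_inj <-.
by move=> Wy; exists y.
Qed.

Lemma picked_Aut (G : closed_subgroup) (a : Aut (set_type G)) W : V G ->
  picked G W -> picked G (a @` W).
Proof. by move=> VG; apply: picked_iso => //; exact: aut_iso. Qed.

Lemma picked_basis G : V G -> coset_basis (picked G).
Proof.
move=> VG; split.
- exact: picked_sub.
- exact: picked_open.
- by move=> x W FW; rewrite -image_inn; exact: picked_Aut.
- have /finite_seqP[cs csP] := P_finite VG.
  have [|r rP rE] := @finite_reps _ _ [set U : closed_subgroup | P U G]
    (fun U c => c = conjugacy_class G U) cs.
    move=> U PU; exists (conjugacy_class G U) => //.
    suff : [set` cs] (conjugacy_class G U) by [].
    by rewrite -csP; exists U.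
  exists [seq set_val @^-1` (U : set Sym) | U : closed_subgroup <- r].
    by move=> _ /mapP[U /rP PU ->]; exists U.
  move=> _ [U PU <-]; have [U0 U0r [c -> UU0]] := rE U PU.
  exists (set_val @^-1` (U0 : set Sym)); first exact: map_f.
  have : conjugacy_class G U U.
    exists 1; first by case: (closed_subgroup_subgroup G).
    apply/seteqP; split=> y /=; first by case=> u Uu <-; rewrite conjg1.
    by move=> Uy; exists y; rewrite ?conjg1.
  rewrite UU0 => -[g Gg gU]; exists ((SigSub (mem_set Gg) : set_type G)^-1).
  set x : set_type G := (X in cjs X).
  have xE y : set_val (x^-1 * y * x) = g^-1^-1 * set_val y * g^-1 :> Sym.
    by [].
  apply/seteqP; split=> y; rewrite /cjs/= xE -gU invgK /=.
    by case=> u U0u <-; rewrite /conjg !mulgA mulgV mul1g mulgK.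
  move=> U0y; exists (g * set_val y * g^-1) => //.
  by rewrite /conjg !mulgA mulVg mul1g mulgVK.
- move=> s; have [|E [/finite_seqP[r ->] rP rs]] := P_sub_basic VG (W := [set x | fixes x s]).
    split; first split=> //.
    + by move=> x y; exact: fixesM.
    + by move=> x; exact: fixesV.
    by apply/open_gact => x fx; exists s => y; exact: fixesM.
  exists [seq set_val @^-1` (U : set Sym) | U : closed_subgroup <- r].
    by move=> _ /mapP[U Ur ->]; exists U => //; exact: rP.
  by move=> x xU; apply: rs => U Ur; apply: xU; exact: map_f.
Qed.

End PickedFamily.

Arguments picked P G : clear implicits.

(** * First-order equivalence of coset structures *)

(* De Bruijn formulas over structures of cosets; [Trans s] states that a single
   left translation maps the [p.1]-th variable to the [p.2]-th, for all [p \in s]. *)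
Inductive formula : Type :=
  | Trans of seq (nat * nat)
  | Neg of formula
  | And of formula & formula
  | Ex of formula.

(** An embedding into a countable type of trees, so that formulas can be listed and a theory becomes
    a sequence of truth values. *)
Fixpoint formula_code (f : formula) : GenTree.tree (seq (nat * nat)) :=
  match f with
  | Trans s => GenTree.Leaf s
  | Neg g => GenTree.Node 0 [:: formula_code g]
  | And g h => GenTree.Node 1 [:: formula_code g; formula_code h]
  | Ex g => GenTree.Node 2 [:: formula_code g]
  end.

Fixpoint formula_decode (t : GenTree.tree (seq (nat * nat))) : formula :=
  match t with
  | GenTree.Leaf s => Trans s
  | GenTree.Node 0 [:: g] => Neg (formula_decode g)
  | GenTree.Node 1 [:: g; h] => And (formula_decode g) (formula_decode h)
  | GenTree.Node 2 [:: g] => Ex (formula_decode g)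
  | _ => Trans [::]
  end.

Lemma formula_codeK : cancel formula_code formula_decode.
Proof. by elim=> //= [f ->|f -> g ->|f ->]. Qed.

Definition formula_enum (n : nat) : formula :=
  if unpickle n is Some t then formula_decode t else Trans [::].

Lemma formula_enum_surj f : exists n, formula_enum n = f.
Proof.
by exists (pickle (formula_code f)); rewrite /formula_enum pickleK formula_codeK.
Qed.

Section Satisfaction.
Variables (G : closed_subgroup) (F : set (set (set_type G))).
Local Notation T := (set_type G).

(** The bounds on indices keep [Trans] from reading the default [set0], over which a coset
    isomorphism has no control. *)
Fixpoint sat (f : formula) (env : seq (set T)) : Prop :=
  match f with
  | Trans s => (forall p, p \in s -> p.1 < size env /\ p.2 < size env)%N /\
      exists x : T, forall p, p \in s -> lcos x (nth set0 env p.1) = nth set0 env p.2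
  | Neg g => ~ sat g env
  | And g h => sat g env /\ sat h env
  | Ex g => exists2 A, cosets F A & sat g (A :: env)
  end.

Lemma sat_true env : sat (Trans [::]) env.
Proof. by split=> //; exists 1. Qed.

Lemma sat_bigAnd (I : eqType) (r : seq I) (f : I -> formula) env :
  sat (foldr (fun i => And (f i)) (Trans [::]) r) env <->
  forall i, i \in r -> sat (f i) env.
Proof.
elim: r => [|i r IH] /=; first by split=> // _; exact: sat_true.
split=> [[fi /IH fr] j|H].
  by rewrite inE => /orP[/eqP ->|/fr].
split; first by apply: H; rewrite inE eqxx.
by apply/IH => j jr; apply: H; rewrite inE jr orbT.
Qed.

End Satisfaction.

Lemma sat_iso (G H : closed_subgroup) (F : set (set (set_type G)))
    (F' : set (set (set_type H))) f g : coset_iso F F' f g ->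
  forall phi env, (forall A, A \in env -> cosets F A) ->
    sat F phi env <-> sat F' phi (map f env).
Proof.
case=> fD gD fl gl; elim=> [s|phi IH|phi IH psi IH'|phi IH] env envD /=.
- rewrite size_map.
  split=> -[sz [x xP]]; split=> //.
    have [y yP] := fl env x envD; exists y => p ps; have [p1 p2] := sz p ps.
    by rewrite !(nth_map set0)// -xP// -yP// mem_nth.
  have [|y yP] := gl (map f env) x; first by move=> _ /mapP[A /envD/fD[? _] ->].
  exists y => p ps; have [p1 p2] := sz p ps; have := xP p ps.
  rewrite !(nth_map set0)// => E.
  have [_ <-] := fD _ (envD _ (mem_nth set0 p2)).
  rewrite -E yP ?map_f ?mem_nth//.
  by have [_ ->] := fD _ (envD _ (mem_nth set0 p1)).
- by split=> N /IH-/(_ envD).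
- by split=> -[/IH-/(_ envD) ? /IH'-/(_ envD) ?].
- have cons_D A : cosets F A -> forall B, B \in A :: env -> cosets F B.
    by move=> DA B; rewrite inE => /orP[/eqP ->|/envD].
  split=> [[A DA /IH-/(_ (cons_D A DA)) sA]|[B /gD[DgB fgB] sB]].
    by exists (f A) => //; case: (fD _ DA).
  exists (g B) => //; apply/IH; first exact: cons_D.
  by rewrite /= fgB.
Qed.

Lemma sat_cjs (G : closed_subgroup) (F : set (set (set_type G))) x phi env :
  coset_basis F -> (forall A, A \in env -> cosets F A) ->
  sat F phi env <-> sat F phi (map (cjs x) env).
Proof.
move=> FB envD.
have ci : coset_iso F F (fun A => inn x @` A) (fun A => inn x^-1 @` A).
  apply: iso_coset_iso.
  - exact: AutM.
  - by move=> y /=; rewrite invgK !mulgA mulVg mul1g mulgVK.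
  - by move=> y /=; rewrite invgK !mulgA mulgV mul1g mulgK.
  - by move=> W FW; rewrite image_inn; exact: cb_conj.
  - by move=> W FW; rewrite image_inn; exact: cb_conj.
rewrite (sat_iso ci phi envD).
by rewrite (eq_map (g := cjs x))// => A; exact: image_inn.
Qed.

Section ElementaryEquivalence.
Variables (G H : closed_subgroup) (F : set (set (set_type G)))
  (F' : set (set (set_type H))).
Hypotheses (FB' : coset_basis F') (H_olig : oligomorphic H).

Definition elem_equiv env env' : Prop :=
  forall phi, sat F phi env <-> sat F' phi env'.

(* If no one-point extension worked, the finitely many orbit representatives
   would be excluded by the conjunction of finitely many formulas. *)
Lemma elem_equiv_extend env env' A :
  (forall B, B \in env' -> cosets F' B) -> elem_equiv env env' -> cosets F A ->
  exists2 B, cosets F' B & elem_equiv (A :: env) (B :: env').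
Proof.
move=> envD' eqv DA.
have [r rD rP] := finite_conjugation_orbits FB' H_olig (size env').+1.
have Hpsi Bs : exists psi, sat F psi (A :: env) /\
    ((exists2 chi, sat F chi (A :: env) & ~ sat F' chi Bs) -> ~ sat F' psi Bs).
  have [[chi]|N] := pselect (exists2 chi, sat F chi (A :: env) & ~ sat F' chi Bs).
    by exists chi.
  by exists (Trans [::]); split=> [|/N//]; exact: sat_true.
have [psi psiP] := ex_choice Hpsi.
have : sat F (Ex (foldr (fun Bs => And (psi Bs)) (Trans [::]) r)) env.
  exists A => //; apply/sat_bigAnd => Bs _; exact: (psiP Bs).1.
move=> /eqv[B DB /sat_bigAnd satB]; exists B => //.
have D' C : C \in B :: env' -> cosets F' C.
  by rewrite inE => /orP[/eqP ->|/envD'].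
have [Bs Br [x xE]] := rP (B :: env') erefl D'.
have sub chi : sat F chi (A :: env) -> sat F' chi (B :: env').
  move=> schi; rewrite xE -sat_cjs//; last exact: rD.
  apply: contrapT => N; apply: (psiP Bs).2; first by exists chi.
  by rewrite (sat_cjs x)// -?xE; [exact: satB|exact: rD].
move=> chi; split; first exact: sub.
(* A formula true only on the other side would make its negation a counterexample to [sub]. *)
by move=> s'; apply: contrapT => /(sub (Neg chi)).
Qed.

End ElementaryEquivalence.

Lemma elem_equiv_sym (G H : closed_subgroup) (F : set (set (set_type G)))
    (F' : set (set (set_type H))) env env' :
  elem_equiv F F' env env' -> elem_equiv F' F env' env.
Proof. by move=> eqv phi; split=> /eqv. Qed.

(** Pairs of tuples satisfying the same formulas form a back-and-forth system, by
    [elem_equiv_extend] in both directions. The formulas [Trans] then turn the resulting bijection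
    into a coset isomorphism. *)
Lemma elem_equiv_iso (G H : closed_subgroup) (F : set (set (set_type G)))
    (F' : set (set (set_type H))) :
  coset_basis F -> coset_basis F' -> oligomorphic G -> oligomorphic H ->
  elem_equiv F F' [::] [::] -> exists f g, coset_iso F F' f g.
Proof.
move=> FB FB' Golig Holig eqv.
pose R (s : seq (set (set_type G) * set (set_type H))) :=
  (forall p, p \in s -> cosets F p.1 /\ cosets F' p.2) /\
  elem_equiv F F' (map fst s) (map snd s).
have RD s : R s -> (forall A, A \in map fst s -> cosets F A) /\
    (forall A, A \in map snd s -> cosets F' A).
  by move=> [sD _]; split=> A /mapP[p /sD[? ?] ->].
have Rcons s A B : R s -> cosets F A -> cosets F' B ->
    elem_equiv F F' (A :: map fst s) (B :: map snd s) -> R ((A, B) :: s).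
  move=> [sD _] DA DB E; split=> // p.
  by rewrite inE => /orP[/eqP ->|/sD].
have forth s A : R s -> cosets F A -> exists2 B, cosets F' B & R ((A, B) :: s).
  move=> Rs DA; have [_ E] := Rs; have [_ D2] := RD s Rs.
  have [B DB AB] := elem_equiv_extend FB' Holig D2 E DA.
  by exists B => //; exact: Rcons.
have back s B : R s -> cosets F' B -> exists2 A, cosets F A & R ((A, B) :: s).
  move=> Rs DB; have [_ E] := Rs; have [D1 _] := RD s Rs.
  have [A DA AB] := elem_equiv_extend FB Golig D1 (elem_equiv_sym E) DB.
  by exists A => //; apply: Rcons => //; exact: elem_equiv_sym.
(* Each [q] in [t] asks for [q.1] to be moved to [q.2]; [index] turns the entries of [s] into
   variables of a formula [Trans]. *)
have Rtrans s (t : seq _) : R s -> (forall q, q \in t -> q.1 \in s /\ q.2 \in s) ->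
    (exists x, forall q, q \in t -> lcos x q.1.1 = q.2.1) <->
    (exists y, forall q, q \in t -> lcos y q.1.2 = q.2.2).
  move=> [_ E] ts.
  have {E} := E (Trans [seq (index q.1 s, index q.2 s) | q <- t]).
  have szP p : p \in [seq (index q.1 s, index q.2 s) | q <- t] ->
      (p.1 < size s /\ p.2 < size s)%N.
    by move=> /mapP[q /ts[q1 q2] ->] /=; rewrite !index_mem.
  have n1 p : p \in s -> nth set0 (map fst s) (index p s) = p.1.
    by move=> ps; rewrite (nth_map (set0, set0)) ?index_mem// nth_index.
  have n2 p : p \in s -> nth set0 (map snd s) (index p s) = p.2.
    by move=> ps; rewrite (nth_map (set0, set0)) ?index_mem// nth_index.
  rewrite /= !size_map => E; split=> -[x xP].
    have [|_ [y yP]] := E.1 _.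
      split=> //; exists x => _ /mapP[q qt ->] /=; have [q1 q2] := ts q qt.
      by rewrite !n1// xP.
    exists y => q qt; have [q1 q2] := ts q qt.
    by rewrite -(n2 _ q1) -(n2 _ q2); apply: (yP (_, _)); apply/mapP; exists q.
  have [|_ [y yP]] := E.2 _.
    split=> //; exists x => _ /mapP[q qt ->] /=; have [q1 q2] := ts q qt.
    by rewrite !n2// xP.
  exists y => q qt; have [q1 q2] := ts q qt.
  by rewrite -(n1 _ q1) -(n1 _ q2); apply: (yP (_, _)); apply/mapP; exists q.
(* Equality is definable: [p.1 = q.1] exactly when one translation maps [p.1] both to itself and to
   [q.1]. *)
have R_inj s p q : R s -> p \in s -> q \in s -> p.1 = q.1 <-> p.2 = q.2.
  move=> Rs ps qs; have [|E1 E2] := Rtrans s [:: (p, p); (p, q)] Rs.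
    by move=> u; rewrite !inE => /orP[/eqP ->|/eqP ->].
  split=> pq.
    have [|y yP] := E1.
      by exists 1 => u; rewrite !inE => /orP[/eqP ->|/eqP ->] /=; rewrite lcos1.
    by rewrite -(yP (p, q)) ?inE ?eqxx ?orbT//= (yP (p, p)) ?inE ?eqxx.
  have [|y yP] := E2.
    by exists 1 => u; rewrite !inE => /orP[/eqP ->|/eqP ->] /=; rewrite lcos1.
  by rewrite -(yP (p, q)) ?inE ?eqxx ?orbT//= (yP (p, p)) ?inE ?eqxx.
have R0 : R [::] by split.
have [e eP] := cosets_enum FB Golig.
have [e' eP'] := cosets_enum FB' Holig.
have [f [g [fP gP fR]]] := back_and_forth eP eP' R0 forth back R_inj.
exists f, g; split=> //.
- move=> l x lD; have [|s Rs sP] := fR (l ++ map (lcos x) l).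
    by move=> A; rewrite mem_cat => /orP[/lD//|/mapP[B /lD DB ->]]; exact: cosets_lcos.
  have [|E _] := Rtrans s [seq ((A, f A), (lcos x A, f (lcos x A))) | A <- l] Rs.
    by move=> _ /mapP[A Al ->]; split; apply: sP; rewrite mem_cat ?map_f ?Al ?orbT.
  have [|y yP] := E; first by exists x => _ /mapP[A Al ->].
  exists y => A Al; apply/esym.
  by apply: (yP ((A, f A), (lcos x A, f (lcos x A)))); apply/mapP; exists A.
- move=> l y lD; have [|s Rs sP] := fR (map g l ++ map (g \o lcos y) l).
    move=> A; rewrite mem_cat => /orP[/mapP[B /lD/gP[? _] ->]//|/mapP[B /lD DB ->]].
    by have [] := gP _ (cosets_lcos y DB).
  have [|_ E] := Rtrans s [seq ((g B, B), (g (lcos y B), lcos y B)) | B <- l] Rs.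
    move=> _ /mapP[B Bl ->] /=; split.
      have [_ {2}<-] := gP _ (lD _ Bl); apply: sP.
      by rewrite mem_cat map_f.
    have [_ {2}<-] := gP _ (cosets_lcos y (lD _ Bl)); apply: sP.
    by rewrite mem_cat; apply/orP; right; apply/mapP; exists B.
  have [|x xP] := E; first by exists y => _ /mapP[B Bl ->].
  exists x => B Bl; apply/esym.
  by apply: (xP ((g B, B), (g (lcos y B), lcos y B))); apply/mapP; exists B.
Qed.

(** * Borel dependence on the group *)

Section MeasurableConditions.
Implicit Types (Q : closed_subgroup -> Prop).

Definition mset Q : Prop := measurable [set G | Q G].

Lemma mset_ext Q Q' : (forall G, Q G <-> Q' G) -> mset Q -> mset Q'.
Proof.
by rewrite /mset => QQ'; rewrite (_ : [set G | Q' G] = [set G | Q G])//;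
  apply/seteqP; split=> G /QQ'.
Qed.

Lemma mset_not Q : mset Q -> mset (fun G => ~ Q G).
Proof. exact: measurableC. Qed.

Lemma mset_and Q Q' : mset Q -> mset Q' -> mset (fun G => Q G /\ Q' G).
Proof. exact: measurableI. Qed.

Lemma mset_or Q Q' : mset Q -> mset Q' -> mset (fun G => Q G \/ Q' G).
Proof. exact: measurableU. Qed.

Lemma mset_cst (A : Prop) : mset (fun=> A).
Proof.
have [a|na] := pselect A.
  by apply: (@mset_ext (fun=> True)) => //; exact: measurableT.
by apply: (@mset_ext (fun=> False)) => //; exact: measurable0.
Qed.

Lemma mset_exists (I : countType) (Q : I -> closed_subgroup -> Prop) :
  (forall i, mset (Q i)) -> mset (fun G => exists i, Q i G).
Proof.
move=> HQ; rewrite /mset.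
rewrite (_ : [set G | _] = \bigcup_i [set G | Q i G]); last first.
  by apply/seteqP; split=> G; [case=> i Qi; exists i|case=> i _ Qi; exists i].
by apply: countable_bigcupT_measurable => // i; exact: HQ.
Qed.

Lemma mset_forall (I : countType) (Q : I -> closed_subgroup -> Prop) :
  (forall i, mset (Q i)) -> mset (fun G => forall i, Q i G).
Proof.
move=> HQ; apply: (@mset_ext (fun G => ~ exists i, ~ Q i G)) => [G|].
  split=> [N i|H [i]]; last exact.
  by apply: contrapT => Ni; apply: N; exists i.
by apply/mset_not/mset_exists => i; exact: mset_not.
Qed.

Lemma mset_imp Q Q' : mset Q -> mset Q' -> mset (fun G => Q G -> Q' G).
Proof.
move=> mQ mQ'; apply: (@mset_ext (fun G => ~ Q G \/ Q' G)) => [G|].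
  split=> [[//|//]|H]; have [q|nq] := pselect (Q G); [right; exact: H|by left].
by apply: mset_or => //; exact: mset_not.
Qed.

Lemma mset_iff Q Q' : mset Q -> mset Q' -> mset (fun G => Q G <-> Q' G).
Proof. by move=> mQ mQ'; apply: mset_and; exact: mset_imp. Qed.

Lemma mset_meeting (W : set Sym) : open W ->
  mset (fun G => exists x : set_type G, W (set_val x)).
Proof.
move=> oW; apply: (@mset_ext (fun G => meeting W (to_effros G))) => [G|].
  split=> [[h [Gh Wh]]|[x Wx]]; first by exists (SigSub (mem_set Gh)).
  by exists (set_val x); split=> //; exact: set_mem (valP x).
exists (meeting W); last by rewrite setTI.
by apply: sub_sigma_algebra; exists W.
Qed.

Definition cylinder (s t : seq nat) : set Sym := [set h : Sym | map h s = t].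

Lemma cylinder_open s t : open (cylinder s t).
Proof.
rewrite openE => h hs; apply/nbhs_Sym; exists s => k kh.
by rewrite /cylinder/= -hs; apply/eq_in_map.
Qed.

Lemma mset_orb s t : mset (fun G => orb G s t).
Proof. exact: mset_meeting (@cylinder_open s t). Qed.

(** Membership in the coded set as a condition on the values [p] at the points of the code; no
    element of [G] is named, so it makes sense uniformly in [G]. *)
Definition coded_at (G : closed_subgroup) (c : code) (p : seq nat) : Prop :=
  exists2 b, b \in c.2 & orb G (c.1 ++ p) (c.1 ++ b).

Lemma coded_atE (G : closed_subgroup) c (x : set_type G) :
  coded G c x <-> coded_at G c (map (gact x) c.1).
Proof. by []. Qed.

Lemma mset_coded_at c p : mset (fun G => coded_at G c p).
Proof.
apply: (@mset_ext (fun G => exists b : seq nat, b \in c.2 /\ orb G (c.1 ++ p) (c.1 ++ b))) => [G|].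
  by split=> [[b [? ?]]|[b ? ?]]; exists b.
by apply: mset_exists => b; apply: mset_and; [exact: mset_cst|exact: mset_orb].
Qed.

Lemma lcos_coded (G : closed_subgroup) c (x : set_type G) :
  fixes x c.1 -> lcos x (coded G c) = coded G c.
Proof.
move=> fx; apply/seteqP; split=> y; rewrite /lcos/= => cy.
  have -> : y = x * (x^-1 * y) * 1 by rewrite mulg1 mulgA mulgV mul1g.
  exact: codedM.
by rewrite -[_ * y]mulg1; apply: codedM => //; exact: fixesV.
Qed.

(** Quantifiers over [G] become countable ones over tuples: [w] holds the values of [u] at the
    points of [c] and of [c'], and those of [x * u] at the points of [c']. The sizes fix where
    concatenations are cut. *)
Lemma mset_not_translate a z c c' :
  mset (fun G => exists x u : set_type G, map (gact x) a = z /\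
    ~ (coded G c u <-> coded G c' (x * u))).
Proof.
apply: (@mset_ext (fun G => exists w : seq nat * seq nat * seq nat,
  ((size w.1.1 = size c.1 /\ size w.1.2 = size c'.1 /\ size z = size a) /\
  orb G (a ++ w.1.2) (z ++ w.2) /\ orb G (c.1 ++ c'.1) (w.1.1 ++ w.1.2)) /\
  ~ (coded_at G c w.1.1 <-> coded_at G c' w.2))) => [G|]; last first.
  apply: mset_exists => w; apply: mset_and.
    by apply: mset_and; [exact: mset_cst|apply: mset_and; exact: mset_orb].
  by apply/mset_not/mset_iff; exact: mset_coded_at.
split=> [[[[p r] q] /= [[[sp [sr sz]] [[x xE] [u uE]]] N]]|[x [u [xz N]]]].
  move: xE uE; rewrite !map_cat => /eqP; rewrite eqseq_cat ?size_map//.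
  move=> /andP[/eqP xa /eqP xr] /eqP; rewrite eqseq_cat ?size_map//.
  move=> /andP[/eqP up /eqP ur].
  by exists x, u; split=> //; rewrite !coded_atE map_gactM ur xr up.
exists (map (gact u) c.1, map (gact u) c'.1, map (gact (x * u)) c'.1) => /=.
split; last by rewrite -!coded_atE.
split; first by rewrite -xz !size_map.
by split; [exists x|exists u]; rewrite map_cat ?xz ?map_gactM.
Qed.

Lemma lcos_codedP (G : closed_subgroup) c c' (x : set_type G) :
  lcos x (coded G c) = coded G c' <->
  forall u, coded G c u <-> coded G c' (x * u).
Proof.
split=> [<- u|H]; first by rewrite /lcos/= mulKg.
apply/seteqP; split=> y; rewrite /lcos/=.
  by move/H; rewrite mulgA mulgV mul1g.
by move=> cy; apply/H; rewrite mulgA mulgV mul1g.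
Qed.

Definition translates (G : closed_subgroup) (s0 t0 : seq nat)
    (l : seq (code * code)) : Prop :=
  exists x : set_type G, map (gact x) s0 = t0 /\
    forall p, p \in l -> lcos x (coded G p.1) = coded G p.2.

(** The effect of [x] on the source sets depends only on its values [z] at the points [a] of their
    codes, whose stabiliser fixes these sets. So countably many [z] replace [x], and
    [mset_not_translate] handles the condition on all [u]. *)
Lemma mset_translates s0 t0 l : mset (fun G => translates G s0 t0 l).
Proof.
pose a := flatten [seq p.1.1 | p <- l].
have fa (G : closed_subgroup) (x : set_type G) p : p \in l -> fixes x a -> fixes x p.1.1.
  move=> pl fx i ip; apply: fx; apply/flattenP; exists p.1.1 => //.
  exact: map_f.
apply: (@mset_ext (fun G => exists z : seq nat,
  (size s0 = size t0 /\ orb G (s0 ++ a) (t0 ++ z)) /\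
  forall p : code * code, p \in l ->
    ~ exists x u : set_type G, map (gact x) a = z /\
    ~ (coded G p.1 u <-> coded G p.2 (x * u)))) => [G|]; last first.
  apply: mset_exists => z; apply: mset_and.
    by apply: mset_and; [exact: mset_cst|exact: mset_orb].
  apply: mset_forall => p; apply: mset_imp; first exact: mset_cst.
  exact/mset_not/mset_not_translate.
split=> [[z [[s0t0 [x]]]]|[x [xs xl]]].
  rewrite map_cat => /eqP; rewrite eqseq_cat ?size_map// => /andP[/eqP xs /eqP xa] H.
  exists x; split=> // p pl; apply/lcos_codedP => u.
  by apply: contrapT => N; apply: (H p pl); exists x, u.
exists (map (gact x) a); split.
  by split; [rewrite -xs size_map|exists x; rewrite map_cat xs].
move=> p pl [y [u [/esym/fixes_map fy]]]; apply; apply: ((lcos_codedP p.1 p.2 y).1 _ u).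
rewrite -xl// -[in LHS](mulVKg x y) lcosM lcos_coded//; exact: fa fy.
Qed.

End MeasurableConditions.

Lemma closed_subgroup_ext (U U' : closed_subgroup) :
  (U : set Sym) = (U' : set Sym) -> U = U'.
Proof.
case: U U' => [[U cU] sU] [[U' cU'] sU'] /= E; subst U'.
have E : cU = cU' by exact: Prop_irrelevance.
by subst cU'; rewrite (Prop_irrelevance sU sU').
Qed.

Lemma left_stabilizer_ex (G : closed_subgroup) (c : code) :
  exists U : closed_subgroup,
  (U : set Sym) = set_val @` [set x : set_type G | lcos x (coded G c) = coded G c].
Proof.
apply: open_subgroup_closed; last by exists c.1 => x; exact: lcos_coded.
split=> [|x y /= xc yc|x /= xc]; first exact: lcos1.
  by rewrite lcosM yc.
by rewrite -[in LHS]xc lcosK.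
Qed.

(* For an open subgroup [A] with code [c], the left stabiliser of [A] is [A]
   itself; unlike the coded set it is a closed subgroup for every [G]. *)
Definition left_stabilizer (c : code) (G : closed_subgroup) : closed_subgroup :=
  sval (cid (left_stabilizer_ex G c)).

Lemma left_stabilizerE c (G : closed_subgroup) : (left_stabilizer c G : set Sym) =
  set_val @` [set x : set_type G | lcos x (coded G c) = coded G c].
Proof. by rewrite /left_stabilizer; case: cid. Qed.

Lemma measurable_left_stabilizer c : measurable_fun setT (left_stabilizer c).
Proof.
have m_eff : measurable_fun setT (to_effros \o left_stabilizer c).
  have E : @measurable _ (effros Sym) = <<s [set meeting W | W in @open Sym] >> by [].
  apply: (measurability _ E).
  move=> _ [_ [W oW <-] <-]; rewrite setTI.
  apply: (@mset_ext (fun G => exists st : seq nat * seq nat,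
    cylinder st.1 st.2 `<=` W /\ translates G st.1 st.2 [:: (c, c)])) => [G|]; last first.
    by apply: mset_exists => st; apply: mset_and; [exact: mset_cst|exact: mset_translates].
  split=> [[[s t] /= [stW [x [xs xc]]]]|[h []]].
    exists (set_val x); split; last exact: stW.
    by rewrite /to_effros/= left_stabilizerE; exists x => //=; apply: (xc (c, c)); rewrite inE.
  rewrite /to_effros/= left_stabilizerE => -[x /= xc <-] Wx.
  have /nbhs_Sym[s sW] : nbhs (set_val x : Sym) W by exact: open_nbhs_nbhs.
  exists (s, map (gact x) s); split=> [k /= ks|/=].
    by apply: sW => i si; move/eq_in_map: ks; exact.
  by exists x; split=> // p; rewrite inE => /eqP ->.
move=> _ B [B' mB' <-]; rewrite (setTI (to_effros @^-1` B')).
exact: m_eff measurableT B' mB'.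
Qed.

Section MeasurableSatisfaction.
Variables (V : set closed_subgroup) (P : closed_subgroup -> closed_subgroup -> Prop).
Hypothesis V_borel : measurable V.
Hypothesis V_oligomorphic : forall G, V G -> oligomorphic G.
Hypothesis P_borel : borel_relation_picking_open_subgroups V P.
Hypothesis V_basis : forall G, V G -> coset_basis (picked P G).

(** A code [d] stands for the picked subgroup. The condition on all [z] says that the coded set
    equals its own left stabiliser, tested on values at the points of [d]; the last clause says that
    [c] codes a translate of it. *)
Lemma cosets_codedP (G : closed_subgroup) c : V G ->
  cosets (picked P G) (coded G c) <->
  exists d, (P (left_stabilizer d G) G /\
    forall z, translates G d.1 z [:: (d, d)] <-> (orb G d.1 z /\ coded_at G d z)) /\
    translates G [::] [::] [:: (d, c)].
Proof.
move=> VG; split=> [[W [x [FW cE]]]|[d [[PU dz] [x [_ xdc]]]]].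
  have sW := cb_sub (V_basis VG) FW.
  have [d dW] := cosets_coded (V_basis VG) (V_oligomorphic VG) (fam_cosets FW).
  have stabW y : lcos y W = W <-> W y.
    have := lcos_stab 1 y sW; by rewrite lcos1 invg1 mul1g mulg1.
  exists d; split; last first.
    by exists x; split=> // p; rewrite inE => /eqP -> /=; rewrite -dW cE.
  split.
    have [U PU UW] := FW; rewrite (_ : left_stabilizer d G = U)//.
    apply: closed_subgroup_ext; rewrite left_stabilizerE -dW.
    have [_ [UG _]] := P_borel.2 _ _ PU.
    apply/seteqP; split=> [_ [y /= /stabW + <-]|h Uh]; first by rewrite -UW.
    exists (SigSub (mem_set (UG _ Uh))) => //=; apply/stabW.
    by rewrite -UW.
  move=> z; split=> [[y [yz /(_ (d, d) (mem_head _ _)) /= yd]]|[[y yz] dz]].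
    split; first by exists y.
    by rewrite -yz -coded_atE -dW; apply/stabW; rewrite dW.
  exists y; split=> // p; rewrite inE => /eqP -> /=.
  by rewrite -dW; apply/stabW; rewrite dW coded_atE yz.
exists (coded G d), x; split; last by rewrite (xdc (d, c) (mem_head _ _)).
exists (left_stabilizer d G) => //.
rewrite left_stabilizerE; apply/seteqP; split=> y /=.
  case=> y' yd /val_inj <-; apply/coded_atE.
  have [|_ //] := (dz (map (gact y') d.1)).1.
  by exists y'; split=> // p; rewrite inE => /eqP ->.
move=> cy; exists y => //.
have [|y' [y'd /(_ (d, d) (mem_head _ _)) /= yd]] := (dz (map (gact y) d.1)).2.
  by split; [exists y|rewrite -coded_atE].
rewrite -[in RHS]yd -(mulVKg y' y) lcosM lcos_coded//.
exact: fixes_map.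
Qed.

Lemma mset_cosets_coded c : mset (fun G => V G /\ cosets (picked P G) (coded G c)).
Proof.
apply: (@mset_ext (fun G => V G /\ exists d,
  (P (left_stabilizer d G) G /\
    forall z, translates G d.1 z [:: (d, d)] <-> (orb G d.1 z /\ coded_at G d z)) /\
    translates G [::] [::] [:: (d, c)])) => [G|].
  by split=> -[VG H]; split=> //; apply/(cosets_codedP c VG).
apply: mset_and => //; apply: mset_exists => d.
apply: mset_and; last exact: mset_translates.
apply: mset_and.
  (* Here Borelness of [P] enters: the condition is its preimage under a measurable map. *)
  have mpair : measurable_fun setT (fun G => (left_stabilizer d G, G)).
    by apply: measurable_fun_pair; [exact: measurable_left_stabilizer|exact: measurable_id].
  by have := mpair measurableT _ P_borel.1; rewrite setTI.
apply: mset_forall => z; apply: mset_iff; first exact: mset_translates.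
by apply: mset_and; [exact: mset_orb|exact: mset_coded_at].
Qed.

(** The quantifier over cosets becomes a countable union over codes. The conjunct [V G] stays
    because cosets are known to have codes only for [G] in [V]. *)
Lemma mset_sat phi (cs : seq code) :
  mset (fun G => V G /\ sat (picked P G) phi (map (coded G) cs)).
Proof.
elim: phi cs => [s|phi IH|phi IH psi IH'|phi IH] cs /=.
- pose c0 : code := ([::], [::]).
  apply: (@mset_ext (fun G => V G /\
    ((forall p, p \in s -> p.1 < size cs /\ p.2 < size cs)%N /\
     translates G [::] [::] [seq (nth c0 cs p.1, nth c0 cs p.2) | p <- s]))) => [G|]; last first.
    apply: mset_and => //; apply: mset_and; [exact: mset_cst|exact: mset_translates].
  rewrite size_map; split=> -[VG [sz [x xP]]]; split=> //; split=> //; exists x.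
    move=> p ps; have [p1 p2] := sz p ps; rewrite !(nth_map c0)//.
    by apply: (xP.2 (_, _)); apply/mapP; exists p.
  split=> // _ /mapP[p ps ->] /=; have [p1 p2] := sz p ps.
  by rewrite -!(nth_map c0 set0)// xP.
- apply: (@mset_ext (fun G => V G /\ ~ (V G /\ sat (picked P G) phi (map (coded G) cs)))) => [G|].
    split=> -[VG N]; split=> //; last by case.
    by move=> sphi; apply: N.
  by apply: mset_and => //; apply: mset_not.
- apply: (@mset_ext (fun G => (V G /\ sat (picked P G) phi (map (coded G) cs)) /\
    (V G /\ sat (picked P G) psi (map (coded G) cs)))) => [G|].
    by split=> [[[? ?] [? ?]]|[? [? ?]]].
  exact: mset_and.
- apply: (@mset_ext (fun G => exists c, (V G /\ cosets (picked P G) (coded G c)) /\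
    (V G /\ sat (picked P G) phi (map (coded G) (c :: cs))))) => [G|].
    split=> [[c [[VG Dc] [_ sc]]]|[VG [A DA sA]]].
      by split=> //; exists (coded G c).
    have [c cA] := cosets_coded (V_basis VG) (V_oligomorphic VG) DA.
    by exists c; rewrite /= -cA.
  by apply: mset_exists => c; apply: mset_and; [exact: mset_cosets_coded|].
Qed.

End MeasurableSatisfaction.

(** * Coding a sequence of Borel sets by a real number *)

Section SmoothBySequence.
Import Order.TTheory GRing.Theory Num.Theory numFieldNormedType.Exports.
Local Open Scope ring_scope.
Variables (R : realType) (d : measure_display) (X : measurableType d).
Variables (C : set X) (E : X -> X -> Prop) (B : nat -> set X).
Hypothesis C_borel : measurable C.
Hypothesis B_borel : forall n, measurable (B n).
Hypothesis E_iff : forall x y, C x -> C y ->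
  (E x y <-> forall n, B n x <-> B n y).

(** Ternary digits 0 and 1: the terms after index [n] sum to at most half of the [n]-th weight, so
    the sum determines all digits. *)
Let u (x : X) (n : nat) : R := \1_(B n) x * (3^-1) ^+ n.

Let u_ge0 x n : 0 <= u x n.
Proof. by rewrite mulr_ge0// exprn_ge0// invr_ge0. Qed.

Let u_le x n : u x n <= (3^-1) ^+ n.
Proof.
by rewrite ler_piMl ?exprn_ge0 ?invr_ge0// indicE; case: (_ \in _).
Qed.

Let u_cvg x : cvgn (series (u x)).
Proof.
apply: (@series_le_cvg _ _ (fun n => 1 * (3^-1) ^+ n)).
- exact: u_ge0.
- by move=> n; rewrite mul1r exprn_ge0// invr_ge0.
- by move=> n; rewrite mul1r; exact: u_le.
- apply: is_cvg_geometric_series; rewrite ger0_norm ?invr_ge0//.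
  by rewrite invf_lt1// ltr1n.
Qed.

Let f (x : X) : R := limn (series (u x)).

Let f_lt x y n : (forall m, (m < n)%N -> B m x <-> B m y) ->
  B n x -> ~ B n y -> f y < f x.
Proof.
move=> eqB Bx By.
(* The extra [(3^-1) ^+ (n + k)], call it [t], makes the induction close: [t / 2 - t / 3] is half of
   the next weight [t / 3]. *)
have H k : ((3^-1) ^+ n + (3^-1) ^+ (n + k)) / 2 <=
    series (u x) (n + k).+1 - series (u y) (n + k).+1.
  elim: k => [|k IH].
    rewrite !addn0 !seriesSr.
    have -> : series (u x) n = series (u y) n.
      rewrite !seriesEord; apply: eq_bigr => i _; rewrite /u; congr (_ * _).
      rewrite !indicE; congr (_%:R); congr nat_of_bool.
      by apply/idP/idP => /set_mem/(eqB _ (ltn_ord i))/mem_set.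
    rewrite /u !indicE mem_set// memNset//= mul0r mul1r addr0 addrAC subrr add0r.
    by lra.
  rewrite addnS [series (u x) _.+2]seriesSr [series (u y) _.+2]seriesSr exprS.
  have h1 := u_ge0 x (n + k).+1; have := u_le y (n + k).+1; rewrite exprS.
  by set t := _ ^+ (n + k) in IH *; set t0 := _ ^+ n in IH * => h2; lra.
have fx_cvg : series (u x) n @[n --> \oo] --> f x by exact: u_cvg.
have fy_cvg : series (u y) n @[n --> \oo] --> f y by exact: u_cvg.
have t_gt0 : 0 < (3^-1) ^+ n / 2 :> R by rewrite divr_gt0// exprn_gt0// invr_gt0.
rewrite -subr_gt0; apply: (lt_le_trans t_gt0).
have -> : f x - f y = limn (fun n => series (u x) n - series (u y) n).
  by apply/esym/cvg_lim => //; exact: cvgB fx_cvg fy_cvg.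
apply: limr_ge; first by apply/cvg_ex; exists (f x - f y); exact: cvgB fx_cvg fy_cvg.
exists n.+1 => // m /= nm; rewrite -(subnKC nm).
apply: le_trans (H _); rewrite ler_pM2r ?invr_gt0// lerDl exprn_ge0//.
Qed.

Lemma smooth_by_sequence : smooth R C E.
Proof.
exists f.
  apply: (measurable_fun_cvg (h := fun n x => series (u x) n)); last first.
    by move=> x _; exact: u_cvg.
  move=> n; rewrite (_ : (fun x => _) = (fun x => \sum_(0 <= i < n) u x i)); last first.
    by apply/funext => x; rewrite seriesEnat.
  apply: measurable_sum => i; apply: measurable_funM; last exact: measurable_cst.
  exact: measurable_indic.
move=> x y Cx Cy; rewrite E_iff//; split=> [H|fxy n].
  rewrite /f (_ : u x = u y)//; apply/funext => n; rewrite /u; congr (_ * _).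
  rewrite !indicE; congr (_%:R); congr nat_of_bool.
  by apply/idP/idP => /set_mem/H/mem_set.
have [//|N] := pselect (B n x <-> B n y).
have ex : exists n, `[< ~ (B n x <-> B n y) >] by exists n; apply/asboolP.
have [m /asboolP Nm mmin] := ex_minnP ex.
have eqB k : (k < m)%N -> B k x <-> B k y.
  by move=> km; apply: contrapT => /asboolP/mmin; rewrite leqNgt km.
have [Bx|Bx] := pselect (B m x); have [By|By] := pselect (B m y).
- by case: Nm.
- by have := f_lt eqB Bx By; rewrite fxy ltxx.
- have eqB' k : (k < m)%N -> B k y <-> B k x by move=> /eqB ->.
  by have := f_lt eqB' By Bx; rewrite fxy ltxx.
- by case: Nm; split.
Qed.

End SmoothBySequence.

Theorem theorem4p7 (R : realType) (V : set closed_subgroup)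
    (P : closed_subgroup -> closed_subgroup -> Prop)
    (V_borel : measurable V)
    (V_oligomorphic : forall G, V G -> oligomorphic G)
    (P_borel : borel_relation_picking_open_subgroups V P)
    (P_invariant : invariant_relation V P)
    (P_sub_basic : sub_basic V P)
    (P_finite : forall G, V G -> finitely_many_conjugacy_classes P G) :
  [/\ smooth R V
        (fun G H => topologically_isomorphic (set_type G) (set_type H)),
      forall G, V G -> quasi_oligomorphic (Aut (set_type G)) &
      forall G, V G -> profinite (Out (set_type G))].
Proof.
have V_basis G (VG : V G) : coset_basis (picked P G).
  exact: (picked_basis P_borel.2 P_invariant P_sub_basic P_finite).
have P_Aut G (VG : V G) (a : Aut (set_type G)) W :
    picked P G W -> picked P G (a @` W).
  exact: (picked_Aut P_borel.2 P_invariant).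
split=> [|G VG|G VG].
- apply: (@smooth_by_sequence R _ _ V _ (fun n =>
    [set G | V G /\ sat (picked P G) (formula_enum n) [::]])) => //.
    move=> n; exact: (mset_sat V_borel V_oligomorphic P_borel V_basis _ [::]).
  move=> G H VG VH; split=> [[phi phi_iso]|GH].
    have [phiM phic [psi psic [phiK psiK]]] := phi_iso.
    have psi_iso : topological_isomorphism psi.
      by split=> //; [exact: (can_morph phiM phiK psiK)|exists phi].
    have ci : coset_iso (picked P G) (picked P H)
        (fun A => phi @` A) (fun A => psi @` A).
      apply: iso_coset_iso => // W FW.
        exact: (picked_iso P_borel.2 P_invariant VG VH phi_iso).
      exact: (picked_iso P_borel.2 P_invariant VH VG psi_iso).
    by move=> n; have /= E := sat_iso ci (formula_enum n) (env := [::]);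
      split=> -[_ /E s]; split=> //; apply: s.
  have eqv : elem_equiv (picked P G) (picked P H) [::] [::].
    move=> phi; have [n <-] := formula_enum_surj phi.
    by have [H1 H2] := GH n; split=> s; [case: H1|case: H2].
  have [f [g ci]] := elem_equiv_iso (V_basis G VG) (V_basis H VH)
    (V_oligomorphic G VG) (V_oligomorphic H VH) eqv.
  have [phi phi_iso _] := coset_iso_top (V_basis G VG) (V_basis H VH) ci.
  by exists phi.
- exact: (Aut_quasi_oligomorphic (V_basis G VG) (V_oligomorphic G VG) (P_Aut G VG)).
- exact: (Out_profinite (V_basis G VG) (V_oligomorphic G VG) (P_Aut G VG)).
Qed.
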